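(* For every $n\geq 2$ and every $m\geq 0$, the initial segment of size $m$ of the balanced order on $X_n$ minimises $\mathrm{gap}(A)$ among all weak antichains $A\subseteq\mathbb{Z}^n$ with $|A|=m$. In particular, for every positive integer $N$, the set $$A_N=\{x\in \mathbb{Z}_{\geq 0}^n: 0\leq x_i\leq N-1\text{ for all } i,\text{ and } x_j=0 \text{ for some } j\}$$ minimises $\mathrm{gap}(A)$ among weak antichains $A\subseteq\mathbb{Z}^n$ of size $|A_N|=N^n-(N-1)^n$.
   Context: A subset $A\subseteq\mathbb{Z}^n$ is a weak antichain if it contains no two elements $x,y$ with $x_i<y_i$ for all $i$. For $1\le i\le n$, $\pi_i:\mathbb{Z}^n\to\mathbb{Z}^{n-1}$ is the projection deleting the $i$-th coordinate. For finite $A$, $\mathrm{gap}(A)=\sum_{i=1}^n|\pi_i(A)|-|A|$. Let $X_n=\{x\in\mathbb{Z}_{\ge0}^n: x_i=0\text{ for some } i\}$ (every subset of $X_n$ is a weak antichain). The balanced order on $X_n$: for distinct $x,y\in X_n$ let $T=\{i: x_i\neq y_i\}$, $M_x=\max_{i\in T}x_i$, $M_y=\max_{i\in T}y_i$; declare $x<y$ if $M_x<M_y$, or if $M_x=M_y$ and $\max\{i\in T: x_i=M_x\}<\max\{i\in T: y_i=M_y\}$. This is a total order on $X_n$; an initial segment of size $m$ is the set of its $m$ smallest elements. *)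

(* Defs.v *)
From mathcomp Require Import all_boot all_order all_algebra.
From mathcomp Require Import finmap.

Set Implicit Arguments.
Unset Strict Implicit.
Unset Printing Implicit Defensive.

Import Order.TTheory GRing.Theory Num.Theory.
Local Open Scope ring_scope.
Local Open Scope fset_scope.

Notation point n := {ffun 'I_n -> int}.

Definition weak_antichain n (A : {fset point n}) : Prop :=
  forall x y : point n, x \in A -> y \in A -> ~ (forall i, x i < y i).

Definition proj n (i : 'I_n) (x : point n) : point n.-1 :=
  [ffun j => x (lift i j)].

Definition gap n (A : {fset point n}) : int :=
  \sum_(i < n) (#|` [fset proj i x | x in A]|)%:Z - (#|` A|)%:Z.

Definition minimises_gap n (m : nat) (I : {fset point n}) : Prop :=
  [/\ weak_antichain I, #|` I| = m &
      forall A : {fset point n},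
        weak_antichain A -> #|` A| = m -> gap I <= gap A].

Definition in_X n (x : point n) : bool :=
  [forall i, 0 <= x i] && [exists i, x i == 0].

Definition diff_coords n (x y : point n) : {set 'I_n} :=
  [set i | x i != y i].

(* The default value 0 is harmless: the order is only used on distinct points
   of X_n, where T is nonempty and all coordinates are nonnegative. *)
Definition max_on n (T : {set 'I_n}) (x : point n) : int :=
  \big[Num.max/0]_(i in T) x i.

(* Coordinates are numbered from 0; the maximum is over a nonempty set whenever
   T is nonempty and x is nonnegative on T. *)
Definition argmax_on n (T : {set 'I_n}) (x : point n) : nat :=
  (\max_(i in T | x i == max_on T x) i)%N.

Definition balanced_lt n (x y : point n) : bool :=
  let T := diff_coords x y in
  (x != y) &&
  ((max_on T x < max_on T y)
   || (max_on T x == max_on T y) && (argmax_on T x < argmax_on T y)%N).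

Definition initial_segment n (m : nat) (I : {fset point n}) : Prop :=
  [/\ forall x, x \in I -> in_X x,
      #|` I| = m &
      forall x y, x \in I -> in_X y -> y \notin I -> balanced_lt x y].

Definition grid_point n N (f : {ffun 'I_n -> 'I_N}) : point n :=
  [ffun i => (f i : nat)%:Z].

(* Presented as an image of a finite type; in_cube_faces is the description
   by coordinates. *)
Definition cube_faces (n N : nat) : {fset point n} :=
  [fset grid_point f | f in [pred f : {ffun 'I_n -> 'I_N} |
                              [exists j, f j == 0%N :> nat]]].

Lemma in_cube_faces n N (x : point n) :
  x \in cube_faces n N <->
  (forall i, 0 <= x i <= N%:Z - 1) /\ (exists j, x j = 0).
Proof.
split.
  case/imfsetP=> f /= /existsP[j /eqP fj0] ->; split=> [i|].
    by rewrite ffunE lerBrDr lez_nat -PoszD lez_nat addn1 ltn_ord.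
  by exists j; rewrite ffunE fj0.
case=> xb [j xj0].
have xabs i : (`|x i|)%N%:Z = x i by apply: gez0_abs; case/andP: (xb i).
have xlt i : (`|x i| < N)%N.
  by rewrite -ltz_nat xabs -lezD1 -lerBrDr; case/andP: (xb i).
apply/imfsetP; exists [ffun i => Ordinal (xlt i)] => /=.
  by apply/existsP; exists j; rewrite ffunE /= xj0.
by apply/ffunP=> i; rewrite !ffunE /= xabs.
Qed.

(* Main.v *)
Require Import Defs.
From mathcomp Require Import all_boot all_order all_algebra.
From mathcomp Require Import fingroup perm finmap zify.

(* After translating A into the nonnegative orthant, zeroing the lowest point of
   every line, one direction after the other, moves a weak antichain into X_n
   without enlarging a projection; pushing points down then makes it a down-set D,
   for which the sum of the projections is n |D| minus the total support size. So
   one has to maximise the total support size of a down-set D of X_n.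

   The balanced order is the order of the keys \sum_i 2 ^ (n (x_i - 1) + i), the
   sum being over the support of x; it is compatible with deleting an equal
   coordinate. By induction on the number of coordinates, compressing the layers
   x_i = t of D to initial segments does not decrease the total support size. The
   points having their only zero at i have to be moved separately, and they fit
   again because initial segments also maximise the number of full-support points
   all of whose facets belong to the set, which is proved in the same induction.

   Let D be compressed, e its last vertex (nonzero coordinate value), and L the
   layer of e. Then |L| is at most the length of the block of the order to which
   position |D \ L| belongs. Such a layer does not beat the |L| points following
   position |D \ L|: the weights along the order form a sequence of blocks, all of
   them prefixes of the sequence for one coordinate less, for which prefixes are
   the lightest windows and the suffixes of a block the heaviest ones. *)

Set Implicit Arguments.
Unset Strict Implicit.
Unset Printing Implicit Defensive.

Import Order.TTheory GRing.Theory Num.Theory.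
Local Open Scope fset_scope.
Local Open Scope nat_scope.

(** * Sequences made of blocks *)

(* [f m] is the total weight of the first [m] points of an order consisting of
   consecutive blocks; block [v] starts at position [base v] and is a prefix of
   length [b v] of the order with totals [g]. The very first point, which lies in
   no block, has weight zero. *)
Section Blocks.

Variables (f g base b : nat -> nat).
Hypothesis g0 : g 0 = 0.
(** [gS] makes a prefix the lightest window of its length, and [gI] makes a suffix of the first
    [b v] positions the heaviest window of its length there. Blocks may be empty, whence the guard
    in [b_mono]. *)
Hypothesis gS : forall u s, g u + g s <= g (u + s).
Hypothesis gI : forall v q r, r <= q -> q <= b v -> g q + g (b v - r) <= g (b v) + g (q - r).
Hypothesis base0 : base 0 = 1.
Hypothesis baseS : forall v, base v.+1 = base v + b v.
Hypothesis b_mono : forall v w, v <= w -> 0 < b w -> b v <= b w.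
Hypothesis base_unbounded : forall m, exists v, m < base v.
Hypothesis f0 : f 0 = 0.
Hypothesis f1 : f 1 = 0.
Hypothesis fE : forall v u, u <= b v -> f (base v + u) = f (base v) + g u.

Lemma base_mono v w : v <= w -> base v <= base w.
Proof.
move=> /subnK <-; elim: (w - v) => [|k IH] //.
by rewrite addSn baseS (leq_trans IH) // leq_addr.
Qed.

Lemma block_of m : 0 < m -> exists v, base v <= m < base v + b v.
Proof.
move=> m0; have [V mV] := base_unbounded m.
elim: V mV => [|V IH] mV; first by lia.
case: (ltnP m (base V)) => [/IH //|le]; exists V.
by rewrite le -baseS.
Qed.

Lemma block_gt m : 1 < m -> exists v, base v < m <= base v + b v.
Proof.
move=> m1; have /block_of[v hv] : 0 < m.-1 by lia.
by exists v; lia.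
Qed.

Lemma g_mono u v : u <= v -> g u <= g v.
Proof. by move=> /subnK <-; have := gS (v - u) u; lia. Qed.

Lemma f_mono u v : u <= v -> f u <= f v.
Proof.
suff fS m : f m <= f m.+1.
  by move=> /subnK <-; elim: (v - u) => [|k IH] //; apply: leq_trans IH (fS _).
case: m => [|m]; first by rewrite f0.
have [//|w /andP[h1 h2]] := @block_of m.+1.
rewrite -(subnKC h1) -addnS !fE; try lia.
by rewrite leq_add2l; apply: g_mono; lia.
Qed.

Lemma f_small q : q <= 1 -> f q = 0.
Proof. by case: q => [|[|q]] // _; rewrite ?f0 ?f1. Qed.

(** The block containing [m] is at least as long as block [v]. If the window stays inside it,
    superadditivity of [g] suffices. Otherwise the window is a suffix of that block followed by a
    prefix of the next nonempty one, and [gI] bounds the two pieces together from below by [g l]. *)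
Lemma block_window v m l : base v <= m -> l <= b v -> f m + g l <= f (m + l).
Proof.
move=> hm hl; have m0 : 0 < m by have := base_mono (leq0n v); lia.
have [w /andP[h1 h2]] := block_of m0.
have vw : v <= w.
  case: (leqP v w) => // lt; have := base_mono lt; rewrite baseS; lia.
have bvw : b v <= b w by apply: b_mono => //; lia.
set y := m - base w; have my : m = base w + y by rewrite /y; lia.
have yb : y < b w by lia.
case: (leqP (y + l) (b w)) => hyl.
  rewrite my -addnA !fE //; last by lia.
  by have := gS y l; lia.
have [|w' /andP[h3 h4]] := @block_of (base w.+1).
  by have := base_mono (leq0n w.+1); lia.
have ww' : w < w'.
  case: (ltnP w w') => // le; have := base_mono le; have := h4; rewrite baseS -baseS.
  have : base w'.+1 <= base w.+1 by apply: base_mono.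
  by rewrite baseS; lia.
have e : base w' = base w.+1 by have := base_mono ww'; lia.
have bw : b w <= b w' by apply: b_mono; lia.
have -> : m + l = base w' + (y + l - b w) by rewrite e baseS; lia.
rewrite fE; last by lia.
rewrite e baseS my !fE //; last by lia.
have := @gI w y (b w - l); rewrite subKn; last by lia.
have -> : y - (b w - l) = y + l - b w by lia.
by move=> H; have := H _ _; lia.
Qed.

(** Split [s] at the start of the block in which it ends. The part before is handled by induction,
    and the rest is a window starting at [u + base v], not before that block. *)
Lemma block_superadditive u s : f u + f s <= f (u + s).
Proof.
elim/ltn_ind: s u => s IH u.
case: (leqP s 1) => hs.
  by rewrite (f_small hs) addn0; apply: f_mono; lia.
have [v /andP[h1 h2]] := block_gt hs.
have {1}-> : s = base v + (s - base v) by lia.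
rewrite fE; last by lia.
have := IH _ h1 u; have := @block_window v (u + base v) (s - base v).
have -> : u + base v + (s - base v) = u + s by lia.
by lia.
Qed.

(** A window of length [r] ending at [q] weighs no more than the suffix of length [r] of block [V].
    If it fits in the block where [q] ends, that block is a prefix of block [V] and [gI] applies.
    Otherwise the part in that block is cut off, induction treats the remainder, and [gS] glues the
    two bounds. *)
Lemma block_suffix_aux V q r : r <= b V -> r <= q -> q <= base V + b V ->
  f q + g (b V - r) <= f (q - r) + g (b V).
Proof.
elim/ltn_ind: r q => r IH q rb rq qB.
case: (leqP q 1) => hq.
  rewrite (f_small hq); have := @g_mono (b V - r) (b V) (leq_subr _ _); lia.
have [u /andP[h1 h2]] := block_gt hq.
have uV : u <= V.
  case: (leqP u V) => // lt; have := base_mono lt; rewrite baseS; lia.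
case: (posnP r) => [->|r0]; first by rewrite !subn0.
have bV : 0 < b V by lia.
have buV := b_mono uV bV.
set y := q - base u; have qy : q = base u + y by rewrite /y; lia.
rewrite {1}qy fE; last by lia.
case: (leqP r y) => ry.
  have -> : q - r = base u + (y - r) by lia.
  rewrite fE; last by lia.
  by have := @gI V y r ry; lia.
have := IH (r - y) _ (base u) _ _ _.
have -> : base u - (r - y) = q - r by lia.
have := gS y (b V - r); have -> : y + (b V - r) = b V - (r - y) by lia.
by lia.
Qed.

(** Induction on [V]: the last block absorbs the last [b V] positions of the window by
    [block_suffix_aux], and the remaining positions are compared one block earlier. *)
Lemma block_suffix V q r : r <= q -> q <= base V ->
  f q + f (base V - r) <= f (base V) + f (q - r).
Proof.
elim: V q r => [|V IH] q r rq.
  by rewrite base0 f1 => q1; rewrite !f_small //; lia.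
rewrite baseS => qB.
case: (leqP r (b V)) => rb.
  have := block_suffix_aux rb rq qB.
  by rewrite -addnBA // !fE ?leq_subr //; lia.
have h1 := @block_suffix_aux V q (b V) (leqnn _) _ qB.
have := IH (q - b V) (r - b V) _ _.
rewrite subnn g0 in h1.
have -> : base V + b V - r = base V - (r - b V) by lia.
have -> : q - b V - (r - b V) = q - r by lia.
by rewrite fE //; lia.
Qed.

End Blocks.

(** Increments of a convex sequence are nondecreasing, so a window gains weight when moved to the
    right. *)
Lemma convex_suffix (f : nat -> nat) :
  (forall k, f k <= f k.+1) -> (forall k, f k.+1 + f k.+1 <= f k + f k.+2) ->
  forall b q r, r <= q -> q <= b -> f q + f (b - r) <= f b + f (q - r).
Proof.
move=> f_mono f_conv.
have step k : forall d, f k.+1 + f (k + d) <= f (k + d).+1 + f k.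
  elim=> [|d IH]; first by rewrite addn0.
  have := f_conv (k + d); rewrite addnS; lia.
move=> b q r rq qb; elim: r rq => [|r IH] rq; first by rewrite !subn0 addnC.
have := IH (ltnW rq); have := step (q - r.+1) (b - q).
have -> : q - r.+1 + (b - q) = b - r.+1 by lia.
have -> : (q - r.+1).+1 = q - r by lia.
have -> : (b - r.+1).+1 = b - r by lia.
lia.
Qed.

Lemma convex_superadditive (f : nat -> nat) : f 0 = 0 ->
  (forall k, f k <= f k.+1) -> (forall k, f k.+1 + f k.+1 <= f k + f k.+2) ->
  forall u s, f u + f s <= f (u + s).
Proof.
move=> f0 f_mono f_conv u s.
have := @convex_suffix f f_mono f_conv (u + s) u u (leqnn _) (leq_addr _ _).
by rewrite subnn addKn f0 addn0.
Qed.

(** * Points, vertices and keys *)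

Section Points.

Variable n : nat.
Local Notation pt := {ffun 'I_n -> nat}.
Implicit Types (x y z : pt) (i j : 'I_n) (A : {set 'I_n}).

Definition upd x i t : pt := [ffun j => if j == i then t else x j].

Lemma updE x i t j : upd x i t j = if j == i then t else x j.
Proof. by rewrite ffunE. Qed.

Lemma upd_eq x i t : upd x i t i = t.
Proof. by rewrite updE eqxx. Qed.

Lemma upd_neq x i t j : j != i -> upd x i t j = x j.
Proof. by rewrite updE => /negbTE->. Qed.

Lemma upd_id x i t : x i = t -> upd x i t = x.
Proof. by move=> <-; apply/ffunP=> j; rewrite updE; case: eqP => [->|]. Qed.

Lemma updK x i s t : upd (upd x i s) i t = upd x i t.
Proof. by apply/ffunP=> j; rewrite !updE; case: eqP. Qed.

Lemma updC x i j s t : i != j -> upd (upd x i s) j t = upd (upd x j t) i s.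
Proof.
move=> ij; apply/ffunP=> k; rewrite !updE.
by case: eqP => [->|//]; rewrite eq_sym (negbTE ij).
Qed.

Lemma upd_inj x y i t : x i = y i -> upd x i t = upd y i t -> x = y.
Proof.
by move=> e /(congr1 (fun z => upd z i (x i))); rewrite !updK {2}e !upd_id.
Qed.

Definition supp x : {set 'I_n} := [set i | x i != 0].

Lemma in_supp x i : (i \in supp x) = (x i != 0).
Proof. by rewrite inE. Qed.

Lemma supp_upd0 x i : supp (upd x i 0) = supp x :\ i.
Proof. by apply/setP=> j; rewrite !inE updE; case: (j =P i). Qed.

Lemma supp_updS x i t : 0 < t -> supp (upd x i t) = i |: supp x.
Proof. by move=> t0; apply/setP=> j; rewrite !inE updE; case: (j =P i) => //; rewrite -lt0n t0. Qed.

Lemma supp_mono x y : (forall i, x i <= y i) -> supp x \subset supp y.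
Proof.
by move=> xy; apply/subsetP=> i; rewrite !inE -!lt0n => /leq_trans; apply.
Qed.

(* The vertices of a point are its nonzero entries, numbered so that larger
   values come later and ties are broken by the coordinate. The value [vtx i 0]
   is junk. *)
Definition vtx i t := n * t.-1 + i.

(** Distinct vertices have distinct numbers, so this is the binary number whose digits mark the
    vertices of [x]. Comparing keys amounts to asking which point owns the largest vertex not shared
    by both. *)
Definition key x := \sum_(i | x i != 0) 2 ^ vtx i (x i).

Lemma vtx_inj i j s t : 0 < s -> 0 < t -> vtx i s = vtx j t -> i = j /\ s = t.
Proof.
case: s t => [//|s] [//|t] _ _; rewrite /vtx /= ![n * _]mulnC => e.
have n0 : 0 < n by apply: leq_ltn_trans (ltn_ord i).
have := congr1 (divn^~ n) e; rewrite !divnMDl // !divn_small // !addn0 => st.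
by split; [apply: val_inj; move: e; rewrite st => /addnI | rewrite st].
Qed.

Lemma vtx_lt i j s t : s < t -> vtx i s.+1 < vtx j t.+1.
Proof. 
move=> st; apply: (@leq_trans (n * s.+1)).
  by rewrite /vtx mulnSr ltn_add2l.
by rewrite /vtx /=; apply: leq_trans (leq_addr _ _); rewrite leq_mul2l st orbT.
Qed.

Lemma vtx_le i s t : s <= t -> vtx i s <= vtx i t.
Proof. by rewrite /vtx leq_add2r leq_mul2l => st; apply/orP; right; lia. Qed.

Lemma sum_pow_lt (P : pred 'I_n) (h : 'I_n -> nat) N :
  {in P &, injective h} -> (forall i, P i -> h i < N) ->
  \sum_(i | P i) 2 ^ h i < 2 ^ N.
Proof.
elim: N P => [|N IH] P h_inj hP.
  by rewrite big_pred0 // => i; apply/negP => /hP.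
rewrite expnS mul2n -addnn.
case: (pickP (fun i => P i && (h i == N))) => [i /andP[Pi /eqP hi]|none].
  rewrite (bigD1 i) //= hi ltn_add2l; apply: IH => [j k /andP[Pj _] /andP[Pk _]|j].
    exact: h_inj.
  case/andP=> Pj ji; have := hP j Pj; rewrite ltnS leq_eqVlt => /orP[|//].
  by rewrite -hi => /eqP/(h_inj _ _ Pj Pi) e; rewrite e eqxx in ji.
apply: ltn_addr; apply: IH => // j Pj; have := hP j Pj.
by rewrite ltnS leq_eqVlt => /orP[e|//]; have := none j; rewrite /= Pj e.
Qed.

Lemma vtx_inj_on x (P : pred 'I_n) :
  {in [pred i | (x i != 0) && P i] &, injective (fun i => vtx i (x i))}.
Proof.
move=> i j; rewrite !inE -!lt0n => /andP[i0 _] /andP[j0 _].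
by case/(vtx_inj i0 j0).
Qed.

Lemma key_ltP x N :
  reflect (forall i, x i != 0 -> vtx i (x i) < N) (key x < 2 ^ N).
Proof.
apply: (iffP idP) => [lt i xi|h].
  rewrite -(ltn_exp2l _ _ (ltnSn 1)); apply: leq_ltn_trans lt.
  by rewrite /key (bigD1 i) //= leq_addr.
apply: sum_pow_lt => // i j; rewrite !unfold_in -!lt0n => i0 j0.
by case/(vtx_inj i0 j0).
Qed.

Lemma key_upd x i t :
  key (upd x i t) = (t != 0) * 2 ^ vtx i t + key (upd x i 0).
Proof.
rewrite /key !(big_mkcond (fun j => _ != 0)) (bigD1 i) //= upd_eq.
rewrite [in RHS](bigD1 i) //= upd_eq /= add0n.
congr (_ + _); first by case: (t != 0); rewrite ?mul1n.
by apply: eq_bigr => j ji; rewrite !upd_neq.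
Qed.

Lemma key_lt_upd x y i t : x i = y i ->
  (key (upd x i t) < key (upd y i t)) = (key x < key y).
Proof.
move=> e; rewrite -[in RHS](upd_id (erefl (x i))) -[in RHS](upd_id (erefl (y i))).
by rewrite e (key_upd x i t) (key_upd y i t) (key_upd x i (y i)) (key_upd y i (y i)) !ltn_add2l.
Qed.

Lemma key_mono x y : (forall i, x i <= y i) -> key x <= key y.
Proof.
move=> xy; rewrite /key !(big_mkcond (fun j => _ != 0)) /=.
apply: leq_sum => i _; have := xy i; case: eqP => //= x0.
case: eqP => [->|_]; first by case: (x i) x0.
by move=> le; rewrite leq_exp2l // vtx_le.
Qed.

(** Shared vertices contribute equally. The other vertices of [x] are distinct and lie below the
    vertex of [y] at [i], so their powers of two add up to less than that single power. *)
Lemma key_lt_witness x y i : y i != 0 -> x i != y i ->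
  (forall j, x j != y j -> x j != 0 -> vtx j (x j) < vtx i (y i)) ->
  key x < key y.
Proof.
move=> yi xyi h; rewrite /key (bigID (fun j => x j == y j)) /= addnC.
rewrite [X in _ < X](bigID (fun j => x j == y j)) /= addnC -[X in _ < X]addnC.
have -> : \sum_(j | (y j != 0) && (x j == y j)) 2 ^ vtx j (y j) =
          \sum_(j | (x j != 0) && (x j == y j)) 2 ^ vtx j (x j).
  apply: eq_big => [j|j /andP[_ /eqP->] //].
  by case: (x j =P y j) => [->|]; rewrite ?andbT ?andbF.
rewrite [X in _ < X]addnC ltn_add2l; apply: leq_trans (_ : 2 ^ vtx i (y i) <= _).
  apply: sum_pow_lt; first exact: vtx_inj_on.
  by move=> j /andP[j0 jT]; apply: h.
by rewrite (bigD1 i) ?yi //= leq_addr.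
Qed.

Definition dominates x y i := [/\ y i != 0, x i != y i &
  forall j, x j != y j -> x j != 0 -> vtx j (x j) < vtx i (y i)].

Lemma dominates_total x y : x != y ->
  (exists i, dominates x y i) \/ (exists i, dominates y x i).
Proof.
move=> xy; have [i0 xyi0] : exists i, x i != y i.
  apply/existsP; rewrite -negb_forall; apply: contra xy => /forallP h.
  by apply/eqP/ffunP=> i; apply/eqP.
(* The deciding vertex is the largest one occurring, in either point, at a coordinate of
   disagreement. *)
pose F i := vtx i (maxn (x i) (y i)).
case: (@arg_maxnP _ i0 (fun i => x i != y i) F xyi0) => i xyi imax.
suff H (u v : pt) : u i < v i -> (forall j, u j != v j ->
    vtx j (maxn (u j) (v j)) <= vtx i (maxn (u i) (v i))) -> dominates u v i.
  have [lt|lt|e] := ltngtP (x i) (y i); last by rewrite e eqxx in xyi.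
    by left; exists i; apply: H.
  right; exists i; apply: H => // j.
  by rewrite eq_sym maxnC [maxn (y i) _]maxnC => /imax.
move=> lt le; have vi : v i != 0 by lia.
split=> // [|j uvj uj]; first by rewrite neq_ltn lt.
have mi : maxn (u i) (v i) = v i by apply/maxn_idPr/ltnW.
have := le j uvj; rewrite mi => lej.
have le2 : vtx j (u j) <= vtx j (maxn (u j) (v j)) by apply/vtx_le/leq_maxl.
rewrite ltn_neqAle (leq_trans le2 lej) andbT; apply/eqP.
case/vtx_inj; rewrite ?lt0n // => ji e; rewrite ji in e.
by rewrite e ltnn in lt.
Qed.

Lemma dominates_lt x y i : dominates x y i -> key x < key y.
Proof. by case; apply: key_lt_witness. Qed.

Lemma key_lt_dominates x y : key x < key y -> exists i, dominates x y i.
Proof.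
move=> lt; case: (@dominates_total x y) => // [|[i /dominates_lt]].
  by apply: contraTneq lt => ->; rewrite ltnn.
by rewrite ltnNge (ltnW lt).
Qed.

Lemma key_inj : injective key.
Proof.
move=> x y e; apply/eqP/contraT.
by case/dominates_total => -[i /dominates_lt]; rewrite e ltnn.
Qed.

(** Division with remainder by [n]. It allows blocks of the order to be numbered by all natural
    numbers. *)
Lemma vtx_surj v : 0 < n -> exists i t, 0 < t /\ v = vtx i t.
Proof.
move=> n0; exists (Ordinal (ltn_pmod v n0)), (v %/ n).+1.
by split=> //; rewrite /vtx /= mulnC -divn_eq.
Qed.

Lemma coord_le_key x i : x i <= key x.
Proof.
case: (posnP (x i)) => [->//|xi].
apply: leq_trans (_ : 2 ^ vtx i (x i) <= _); last first.
  by rewrite /key (bigD1 i) -?lt0n //= leq_addr.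
apply: leq_trans (ltn_expl (vtx i (x i)) (ltnSn 1)).
have n0 : 0 < n by apply: leq_ltn_trans (ltn_ord i).
by have := leq_pmull (x i).-1 n0; rewrite /vtx; lia.
Qed.

Lemma key_lt_coord x N : (forall i, x i <= N) -> key x < 2 ^ (n * N).
Proof.
move=> xN; apply/key_ltP => i xi; rewrite -lt0n in xi.
have h : n * (x i).-1 + n <= n * N by rewrite -mulnSr prednK // leq_mul2l xN orbT.
by apply: leq_trans h; rewrite ltn_add2l.
Qed.

End Points.

(** * Initial segments, down-sets and layers *)

Section Segments.

Variable n : nat.
Local Notation pt := {ffun 'I_n -> nat}.
Implicit Types (x y z : pt) (i j : 'I_n) (P : pred pt) (D I J S : {fset pt}).

Definition of_box K (f : {ffun 'I_n -> 'I_K.+1}) : pt := [ffun i => val (f i)].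

Definition box K : {fset pt} := [fset of_box f | f in {: {ffun 'I_n -> 'I_K.+1}}].

Lemma in_box K x : (x \in box K) = [forall i, x i <= K].
Proof.
apply/imfsetP/forallP => [[f _ ->] i|xK]; first by rewrite ffunE -ltnS ltn_ord.
exists [ffun i => inord (x i)] => //; apply/ffunP=> i.
by rewrite !ffunE /= inordK // ltnS.
Qed.

(** The box serves only to make the set finite: a coordinate never exceeds the key, so no point with
    key below [K] is lost. *)
Definition seg P K : {fset pt} := [fset x in box K | P x && (key x < K)].

Lemma in_seg P K x : (x \in seg P K) = P x && (key x < K).
Proof.
rewrite !inE in_box; apply/andP/idP => [[]//|h]; split=> //.
by apply/forallP=> i; case/andP: h => _ /ltnW; apply: leq_trans (coord_le_key x i).
Qed.

Lemma card_segS P K : #|` seg P K.+1| <= #|` seg P K|.+1.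
Proof.
case: (boolP [exists x : seg P K.+1, key (fsval x) == K]) => [/existsP[x /eqP ex]|].
  apply: leq_trans (_ : #|` fsval x |` seg P K| <= _); last by rewrite cardfsU1; lia.
  apply: fsubset_leq_card; apply/fsubsetP=> y; rewrite in_fset1U !in_seg.
  case/andP=> Py; rewrite ltnS leq_eqVlt Py => /orP[/eqP e|->]; last by rewrite orbT.
  by rewrite (@key_inj _ y (fsval x)) ?eqxx // ex.
rewrite negb_exists => /forallP h; apply: leqW; apply: fsubset_leq_card.
apply/fsubsetP=> y yS; have := h [` yS]; have := yS; rewrite /= !in_seg.
by case/andP=> ->; rewrite ltnS leq_eqVlt => /orP[->|].
Qed.

(** A discrete intermediate value argument: keys are injective, so raising the threshold by one adds
    at most one point. *)
Lemma seg_ivt P B m : m <= #|` seg P B| -> exists2 K, K <= B & #|` seg P K| = m.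
Proof.
elim: B => [|B IH].
  have -> : seg P 0 = fset0 by apply/fsetP=> x; rewrite in_seg ltn0 andbF inE.
  by rewrite cardfs0 leqn0 => /eqP->; exists 0; rewrite // ?cardfs0;
     apply/eqP; rewrite cardfs_eq0; apply/eqP/fsetP=> x; rewrite in_seg ltn0 andbF inE.
case: (leqP m #|` seg P B|) => [/IH[K KB e] _|lt le].
  by exists K => //; apply: leqW.
by exists B.+1 => //; have := card_segS P B; lia.
Qed.

Definition initial P I := exists K, I = seg P K.

Lemma initialP P I : (forall x, x \in I -> P x) ->
  (forall x y, x \in I -> P y -> key y < key x -> y \in I) -> initial P I.
Proof.
move=> IP Icl; exists (\max_(x <- I) (key x).+1); apply/fsetP=> y; rewrite in_seg.
apply/idP/andP => [yI|[Py]].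
  by split; [apply: IP | apply: (@leq_bigmax_seq _ _ _ (fun x => (key x).+1))].
move=> h; apply: contraTT h => yI; rewrite -leqNgt.
apply/bigmax_leqP_seq => x xI _; rewrite ltn_neqAle; apply/andP; split.
  by apply: contraNneq yI => /key_inj<-.
by rewrite leqNgt; apply: contra yI => /(Icl _ _ xI Py).
Qed.

Lemma initial_pred P I x : initial P I -> x \in I -> P x.
Proof. by case=> K ->; rewrite in_seg => /andP[]. Qed.

Lemma initial_closed P I x y :
  initial P I -> x \in I -> P y -> key y <= key x -> y \in I.
Proof.
by case=> K ->; rewrite !in_seg => /andP[_ xK] -> /leq_ltn_trans/(_ xK).
Qed.

Lemma initial_sub P I J :
  initial P I -> initial P J -> #|` I| <= #|` J| -> I `<=` J.
Proof.
case=> K -> [K' ->].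
have mono a b : a <= b -> seg P a `<=` seg P b.
  by move=> ab; apply/fsubsetP=> x; rewrite !in_seg => /andP[-> /leq_trans->].
case: (leqP K K') => [/mono //|/ltnW /mono s h].
suff -> : seg P K' = seg P K by apply: fsubset_refl.
by apply/eqP; rewrite eqEfcard s.
Qed.

Lemma initial_eq P I J :
  initial P I -> initial P J -> #|` I| = #|` J| -> I = J.
Proof.
move=> hI hJ e; apply/eqP; rewrite eqEfsubset.
by rewrite !(initial_sub hI hJ, initial_sub hJ hI) // e.
Qed.

(** The threshold is found by a bounded search, which keeps the definition total. The size is [m] as
    soon as [P] has [m] points with coordinates at most [m.+1]; if the search fails, the value is
    junk. *)
Definition Iseg P m : {fset pt} :=
  seg P (find (fun K => #|` seg P K| == m) (iota 0 (2 ^ (n * m.+1)).+1)).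

Lemma Iseg_initial P m : initial P (Iseg P m).
Proof. by eexists. Qed.

Lemma card_Iseg_seg P m B :
  B <= 2 ^ (n * m.+1) -> m <= #|` seg P B| -> #|` Iseg P m| = m.
Proof.
move=> hB /seg_ivt[K KB e].
have h : has (fun K => #|` seg P K| == m) (iota 0 (2 ^ (n * m.+1)).+1).
  by apply/hasP; exists K; rewrite ?mem_iota ?e //=; lia.
have := nth_find 0 h; rewrite nth_iota; last by rewrite has_find size_iota in h.
by rewrite add0n => /eqP.
Qed.

Opaque Iseg.

Lemma card_Iseg P m (e : nat -> pt) : injective e ->
  (forall t, t < m -> P (e t)) -> (forall t i, t < m -> e t i <= m.+1) ->
  #|` Iseg P m| = m.
Proof.
move=> e_inj eP em; apply: (card_Iseg_seg (leqnn _)).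
have -> : m = #|` [fset e (val t) | t in 'I_m]|.
  by rewrite card_imfset /= -?cardE ?card_ord // => a b /e_inj/val_inj.
apply: fsubset_leq_card; apply/fsubsetP => _ /imfsetP[t _ ->].
by rewrite in_seg eP //= card_imfset /= -?cardE ?card_ord ?key_lt_coord //
  => [i|a b /e_inj/val_inj//]; apply: em.
Qed.

Lemma Iseg_eq P I : initial P I -> #|` Iseg P #|` I| | = #|` I| ->
  Iseg P #|` I| = I.
Proof. by move=> hI; apply: (initial_eq (Iseg_initial P _) hI). Qed.

(** The sets [I] minus [S] and [S] minus [I] have the same size, but keys in the former are below
    the threshold and keys in the latter are not. The equality case makes the key sum a termination
    measure for compression. *)
Lemma initial_key_sum P S I : (forall x, x \in S -> P x) -> initial P I ->
  #|` I| = #|` S| ->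
  \sum_(x <- I) key x <= \sum_(x <- S) key x ?= iff (I == S).
Proof.
move=> SP [K ->] e; set I' := seg P K.
have := cardfsID S I'; have := cardfsID I' S; rewrite fsetIC e => e1 e2.
have ed : #|` I' `\` S| = #|` S `\` I'| by lia.
rewrite (big_fsetID _ (mem S)) [in X in _ <= X ?= iff _](big_fsetID _ (mem I')) /=.
have sepI (A B : {fset pt}) : [fset x in A | x \in B] = A `&` B.
  by apply/fsetP=> x; rewrite !inE.
have sepD (A B : {fset pt}) : [fset x in A | x \notin B] = A `\` B.
  by apply/fsetP=> x; rewrite !inE andbC.
rewrite !sepI !sepD fsetIC.
set a := \sum_(x <- I' `\` S) _; set b := \sum_(x <- S `\` I') _.
have ha : a + #|` I' `\` S| <= K * #|` I' `\` S|.
  rewrite /a card_fset_sum1 -big_split big_distrr /= !big_seq.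
  by apply: leq_sum => x; rewrite in_fsetD in_seg muln1 addn1 => /and3P[].
have hb : K * #|` S `\` I'| <= b.
  rewrite /b card_fset_sum1 big_distrr /= !big_seq.
  apply: leq_sum => x; rewrite in_fsetD muln1 => /andP[nI /SP Px].
  by rewrite in_seg Px -leqNgt in nI.
rewrite ed in ha; split; first by lia.
rewrite eqn_add2l eqEfcard e leqnn andbT -fsetD_eq0 -cardfs_eq0 ed.
apply/eqP/eqP => h; first lia.
have hS : S `\` I' = fset0 by apply/cardfs0_eq.
have hI : I' `\` S = fset0 by apply/cardfs0_eq; rewrite ed.
by rewrite /a /b hS hI.
Qed.

(** * Weights, down-sets and layers *)

Definition weight D := \sum_(x <- D) #|supp x|.

Definition down D := forall x y, x \in D -> (forall i, y i <= x i) -> y \in D.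

Definition lay i t D : {fset pt} := [fset upd x i 0 | x in D & x i == t].

Lemma in_lay i t D y : (y \in lay i t D) = (y i == 0) && (upd y i t \in D).
Proof.
apply/imfsetP/andP => [[x /=]|[/eqP yi yD]].
  rewrite !inE => /andP[xD /eqP xi] ->; rewrite upd_eq updK upd_id //; split=> //.
by exists (upd y i t); rewrite ?inE /= ?yD ?upd_eq ?eqxx // updK upd_id.
Qed.

Lemma lay_sum i t D (F : pt -> nat) :
  \sum_(y <- lay i t D) F (upd y i t) = \sum_(x <- D | x i == t) F x.
Proof.
have -> : lay i t D = [fset upd x i 0 | x in [fset x in D | x i == t]].
  apply/fsetP=> y; apply/imfsetP/imfsetP => -[x /= xD ->]; exists x => //.
    by move: xD; rewrite !inE.
  by move: xD; rewrite !inE.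
rewrite big_imfset /= => [|x y]; last first.
  rewrite !inE => /andP[_ /eqP xi] /andP[_ /eqP yi].
  by apply: upd_inj; rewrite xi.
rewrite [in RHS]big_fset_condE !big_seq; apply: eq_bigr => x.
by rewrite !inE => /andP[_ /eqP xi]; rewrite updK upd_id.
Qed.

Lemma sum_lays i B D (F : pt -> nat) : (forall x, x \in D -> x i <= B) ->
  \sum_(x <- D) F x = \sum_(t < B.+1) \sum_(y <- lay i t D) F (upd y i t).
Proof.
move=> DB; rewrite big_seq (partition_big (fun x => inord (x i) : 'I_B.+1) xpredT) //=.
apply: eq_bigr => t _; rewrite lay_sum [in RHS]big_seq_cond.
apply: eq_bigl => x; case: (boolP (x \in D)) => //= xD.
by rewrite -val_eqE /= inordK // ltnS DB.
Qed.

Definition put i t S : {fset pt} := [fset upd y i t | y in S].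

Lemma in_put i t S x : (forall y, y \in S -> y i = 0) ->
  (x \in put i t S) = (x i == t) && (upd x i 0 \in S).
Proof.
move=> Si; apply/imfsetP/andP => [[y /= yS ->]|[/eqP xi yS]].
  by rewrite upd_eq updK upd_id ?Si.
by exists (upd x i 0); rewrite //= updK upd_id.
Qed.

Lemma put_sum i t S (F : pt -> nat) : (forall y, y \in S -> y i = 0) ->
  \sum_(x <- put i t S) F x = \sum_(y <- S) F (upd y i t).
Proof.
move=> Si; rewrite big_imfset //= => x y xS yS.
by apply: upd_inj; rewrite !Si.
Qed.

End Segments.

(** * Faces and spanned points *)

Section Faces.

Variable n : nat.
Local Notation pt := {ffun 'I_n -> nat}.
Implicit Types (x y z : pt) (i j c : 'I_n) (C : {set 'I_n}) (D I L S : {fset pt}).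

(* [XC C] is X_n on the coordinates [C]: the points vanishing outside of [C] and
   at some coordinate of [C]. *)
Definition XC C : pred pt := fun x => supp x \proper C.
Definition PC C : pred pt := fun x => supp x == C.

Lemma XC_zero C x i : XC C x -> i \notin C -> x i = 0.
Proof.
by move=> /proper_sub/subsetP s; apply: contraNeq; rewrite -in_supp => /s.
Qed.

Lemma PC_zero C x i : PC C x -> i \notin C -> x i = 0.
Proof. by move=> /eqP <-; rewrite in_supp negbK => /eqP. Qed.

Lemma XC_upd0 C x i : i \in C -> XC C x -> x i != 0 -> XC (C :\ i) (upd x i 0).
Proof.
move=> iC xC xi; rewrite /XC supp_upd0 properEcard; apply/andP; split.
  by apply: setSD; apply: proper_sub.
by have := proper_card xC; rewrite (cardsD1 i (supp x)) (cardsD1 i C) iC in_supp xi.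
Qed.

Lemma XC_upd C y i t : i \in C -> 0 < t -> XC (C :\ i) y -> XC C (upd y i t).
Proof.
move=> iC t0 yC; rewrite /XC supp_updS // properEcard; apply/andP; split.
  by rewrite subUset sub1set iC (subset_trans (proper_sub yC)) ?subsetDl.
rewrite cardsU1 in_supp (XC_zero yC) ?inE ?eqxx //= add1n.
by have := proper_card yC; rewrite [#|C|](cardsD1 i) iC.
Qed.

Lemma XC_D1 C y i : i \in C -> XC (C :\ i) y -> XC C y.
Proof. by move=> iC /proper_sub h; apply: sub_proper_trans h (properD1 iC). Qed.

Lemma PC_upd C y i t : i \in C -> 0 < t -> PC (C :\ i) y -> PC C (upd y i t).
Proof. by move=> iC t0 /eqP yC; rewrite /PC supp_updS // yC setD1K. Qed.

Lemma PC_upd0 C x i : PC C x -> PC (C :\ i) (upd x i 0).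
Proof. by move=> /eqP xC; rewrite /PC supp_upd0 xC. Qed.

Lemma PC_facet C x i : i \in C -> PC C x -> XC C (upd x i 0).
Proof. by move=> iC /eqP xC; rewrite /XC supp_upd0 xC properD1. Qed.

Lemma XC_le C x y : (forall i, y i <= x i) -> XC C x -> XC C y.
Proof. by move=> /supp_mono s; apply: sub_proper_trans. Qed.

(** The box is large enough when [C] has at least two elements: each coordinate in [C] survives in a
    facet obtained by zeroing another one, and is bounded by the key of that facet. *)
Definition Sup C D : {fset pt} :=
  [fset x in box n (\max_(y <- D) key y) | PC C x && [forall i in C, upd x i 0 \in D]].

Definition spn C D := #|` Sup C D|.

Lemma other_elt C i : 1 < #|C| -> exists2 j, j \in C & j != i.
Proof.
move=> C2; have : 0 < #|C :\ i|.
  by move: C2; rewrite (cardsD1 i C); case: (i \in C) => // /ltnW.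
by case/card_gt0P=> j; rewrite !inE => /andP[ji jC]; exists j.
Qed.

Lemma SupP C D x : 1 < #|C| ->
  reflect (PC C x /\ forall i, i \in C -> upd x i 0 \in D) (x \in Sup C D).
Proof.
move=> C2; rewrite in_fset !inE in_box; apply: (iffP and3P).
  by case=> _ xC /forall_inP.
case=> xC xD; split=> //; last exact/forall_inP.
apply/forallP=> i; case: (boolP (i \in C)) => [_|/(PC_zero xC)->//].
have [j jC ji] := other_elt i C2.
have ij : i != j by rewrite eq_sym.
rewrite -(upd_neq x 0 ij); apply: leq_trans (coord_le_key _ _) _.
exact: (@leq_bigmax_seq _ _ _ (@key n)) (xD j jC) _.
Qed.

(* If [y] precedes [x], every facet of [y] precedes some facet of [x]. *)
Lemma Sup_initial C I : 1 < #|C| -> initial (XC C) I -> initial (PC C) (Sup C I).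
Proof.
move=> C2 hI; apply: initialP => [x /(SupP _ _ C2)[]//|x y].
case/(SupP _ _ C2) => xC xI yC yx; apply/(SupP _ _ C2); split=> // i iC.
have [c [xc yxc cmax]] := key_lt_dominates yx.
suff [j jC le] : exists2 j, j \in C & key (upd y i 0) <= key (upd x j 0).
  exact: initial_closed hI (xI j jC) (PC_facet iC yC) le.
have cC : c \in C by apply: contraNT xc => /(PC_zero xC)->.
case: (eqVneq (y i) (x i)) => [e|yxi].
  by exists i => //; rewrite ltnW // key_lt_upd.
(* If [y] has at some [j] other than [c] an entry preceding the vertex of [x] at [c], zero [j] in
   [x]: the vertex at [c] remains and still decides the comparison. *)
case: (pickP [pred j in C | (j != c) && (vtx j (y j) < vtx c (x c))]) => [j|none].
  case/and3P=> jC jc yj; exists j => //; apply/ltnW/(@dominates_lt _ _ _ c).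
  have cj : c != j by rewrite eq_sym.
  split; first by rewrite (upd_neq x 0 cj).
    by rewrite (upd_neq x 0 cj) updE; case: (c =P i) => // _; rewrite eq_sym.
  move=> k; rewrite (upd_neq x 0 cj); case: (eqVneq k i) => [->|ki].
    by rewrite upd_eq.
  rewrite (upd_neq _ _ ki); case: (eqVneq k j) => [-> //|kj].
  by rewrite (upd_neq _ _ kj); apply: cmax.
(* Otherwise [x] and [y] agree on [C] away from [c], so [i] is [c] and the two facets coincide. *)
have yx_eq k : k \in C -> k != c -> y k = x k.
  move=> kC kc; apply/eqP; apply: contraFT (none k) => ykx.
  by rewrite /= kC kc cmax //; rewrite -in_supp (eqP yC).
have ic : i = c by apply/eqP; apply: contraNT yxi => ic; apply/eqP/yx_eq.
exists c => //; rewrite ic; apply: key_mono => k; rewrite !updE; case: eqP => // /eqP kc.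
case: (boolP (k \in C)) => kC; first by rewrite yx_eq.
by rewrite (PC_zero yC kC).
Qed.

Definition zpt : pt := [ffun=> 0].

Lemma supp_zpt : supp zpt = set0.
Proof. by apply/setP=> i; rewrite !inE ffunE. Qed.

Lemma XC_zpt C : 0 < #|C| -> XC C zpt.
Proof. by rewrite card_gt0 /XC supp_zpt proper0. Qed.

Lemma XC_single C i t : 1 < #|C| -> i \in C -> XC C (upd zpt i t).
Proof.
move=> C2 iC; rewrite /XC properEcard; apply/andP; split.
  apply/subsetP=> j; rewrite in_supp updE; case: (j =P i) => [->//|_].
  by rewrite ffunE.
apply: leq_ltn_trans C2; rewrite -(cards1 i); apply: subset_leq_card.
apply/subsetP=> j; rewrite in_supp updE inE; case: (j =P i) => // _.
by rewrite ffunE.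
Qed.

Lemma key_single i t : 0 < t -> key (upd zpt i t) = 2 ^ vtx i t.
Proof.
move=> t0; rewrite key_upd upd_id ?ffunE // -lt0n t0 mul1n /key big_pred0 ?addn0 //.
by move=> j; rewrite ffunE.
Qed.

Lemma card_Iseg_XC C m : 1 < #|C| -> #|` Iseg (XC C) m| = m.
Proof.
move=> C2; have /card_gt0P[i iC] : 0 < #|C| by lia.
apply: (@card_Iseg _ _ _ (fun t => upd zpt i t)).
- by move=> s t /(congr1 (fun x : pt => x i)); rewrite !upd_eq.
- by move=> t _; apply: XC_single.
- by move=> t j tm; rewrite updE; case: eqP => _; rewrite ?ffunE //; lia.
Qed.

Lemma card_Iseg_PC C m : 0 < #|C| -> #|` Iseg (PC C) m| = m.
Proof.
case/card_gt0P=> i iC.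
apply: (@card_Iseg _ _ _ (fun t => upd [ffun j => nat_of_bool (j \in C)] i t.+1)).
- by move=> s t /(congr1 (fun x : pt => x i)); rewrite !upd_eq => -[].
- move=> t _; rewrite /PC supp_updS //; apply/eqP/setP=> j.
  by rewrite !inE ffunE; case: (j =P i) => [->|_]; rewrite ?iC //; case: (j \in C).
- by move=> t j tm; rewrite updE; case: eqP => _; rewrite ?ffunE; lia.
Qed.

Lemma down_initial C I : initial (XC C) I -> down I.
Proof.
move=> hI x y xI yx; apply: (initial_closed hI xI _ (key_mono yx)).
exact: XC_le yx (initial_pred hI xI).
Qed.

Definition fmax C m := weight (Iseg (XC C) m).
Definition rmax C m := spn C (Iseg (XC C) m).

(* The second bound is what keeps compressions inside the class of down-sets. *)
Definition extremal C := forall D, down D -> (forall x, x \in D -> XC C x) ->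
  weight D <= fmax C #|` D| /\ spn C D <= rmax C #|` D|.

(** * Renaming coordinates *)

Implicit Type s : {perm 'I_n}.

Definition ren (s : {perm 'I_n}) x : pt := [ffun j => x (s j)].

Lemma ren_inj s : injective (ren s).
Proof.
move=> x y e; apply/ffunP=> i; have := congr1 (fun z : pt => z ((s^-1)%g i)) e.
by rewrite !ffunE permKV.
Qed.

Lemma supp_ren s x : supp (ren s x) = s @^-1: supp x.
Proof. by apply/setP=> j; rewrite !inE ffunE. Qed.

Lemma card_preimset_perm s C : #|s @^-1: C| = #|C|.
Proof. by rewrite card_preimset //; apply: perm_inj. Qed.

Lemma XC_ren s C x : XC (s @^-1: C) (ren s x) = XC C x.
Proof.
rewrite /XC supp_ren !properEcard !card_preimset_perm; congr (_ && _).
apply/subsetP/subsetP => h j; last by have := h (s j); rewrite !inE.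
by have := h ((s^-1)%g j); rewrite !inE permKV.
Qed.

Lemma PC_ren s C x : PC (s @^-1: C) (ren s x) = PC C x.
Proof.
rewrite /PC supp_ren; apply/eqP/eqP => [|->//] e; apply/setP=> j.
by have := congr1 (fun A : {set 'I_n} => (s^-1)%g j \in A) e; rewrite !inE permKV.
Qed.

Lemma card_ren s D : #|` ren s @` D| = #|` D|.
Proof. by rewrite card_imfset //=; apply: ren_inj. Qed.

Lemma weight_ren s D : weight (ren s @` D) = weight D.
Proof.
rewrite /weight big_imfset /= => [|x y _ _]; last exact: ren_inj.
by apply: eq_bigr => x _; rewrite supp_ren card_preimset_perm.
Qed.

Lemma spn_ren s C D : 1 < #|C| -> spn C D <= spn (s @^-1: C) (ren s @` D).
Proof.
move=> C2; rewrite /spn -(card_ren s (Sup C D)); apply: fsubset_leq_card.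
have C2' : 1 < #|s @^-1: C| by rewrite card_preimset_perm.
apply/fsubsetP=> _ /imfsetP[x /= /(SupP _ _ C2)[xC xD] ->].
apply/(SupP _ _ C2'); split=> [|i]; first by rewrite PC_ren.
rewrite inE => /xD h; apply/imfsetP; exists (upd x (s i) 0) => //=.
by apply/ffunP=> j; rewrite !ffunE (inj_eq perm_inj).
Qed.

Lemma down_ren s D : down D -> down (ren s @` D).
Proof.
move=> dD _ y /imfsetP[x /= xD ->] yx; apply/imfsetP => /=.
exists (ren (s^-1)%g y); last by apply/ffunP=> j; rewrite !ffunE permK.
by apply: dD xD _ => i; have := yx ((s^-1)%g i); rewrite !ffunE permKV.
Qed.

Lemma extremal_ren s C : 1 < #|C| -> extremal (s @^-1: C) -> forall m,
  fmax C m <= fmax (s @^-1: C) m /\ rmax C m <= rmax (s @^-1: C) m.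
Proof.
move=> C2 ex m; have [|x|] := ex (ren s @` Iseg (XC C) m).
- exact/down_ren/down_initial/Iseg_initial.
- case/imfsetP=> y /= yI ->; rewrite XC_ren.
  exact: initial_pred (Iseg_initial _ _) yI.
- rewrite weight_ren card_ren card_Iseg_XC // => h1 h2; split=> //.
  exact: leq_trans (spn_ren _ _ C2) h2.
Qed.

Lemma tperm_preim C a b : a \in C -> b \in C ->
  tperm a b @^-1: (C :\ a) = C :\ b.
Proof.
move=> aC bC; apply/setP=> j; rewrite !inE.
by case: tpermP => [->|->|/eqP/negbTE ja /eqP/negbTE->]; rewrite ?ja ?aC ?bC ?eqxx ?andbT //=
   1?eq_sym.
Qed.

(** Swapping [a] and [b] need not preserve the order, but it sends initial segments to down-sets, so
    extremality on each side bounds one maximum by the other. *)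
Lemma extremal_max_eq C a b : 2 < #|C| -> a \in C -> b \in C ->
  extremal (C :\ a) -> extremal (C :\ b) ->
  fmax (C :\ a) =1 fmax (C :\ b) /\ rmax (C :\ a) =1 rmax (C :\ b).
Proof.
move=> C3 aC bC exa exb.
have C2 c : c \in C -> 1 < #|C :\ c| by move=> cC; rewrite (cardsD1 c) cC in C3.
have := tperm_preim aC bC; have := tperm_preim bC aC => eb ea.
have ha := @extremal_ren (tperm a b) (C :\ a); rewrite ea in ha.
have hb := @extremal_ren (tperm b a) (C :\ b); rewrite eb in hb.
split=> m; have [h1 h2] := ha (C2 a aC) exb m; have [h3 h4] := hb (C2 b bC) exa m.
  by apply/anti_leq/andP; split; [exact: h1 | exact: h3].
by apply/anti_leq/andP; split; [exact: h2 | exact: h4].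
Qed.

(** The position at which the block of points with last vertex [v] starts: the points counted have
    all their vertices below [v]. *)
Definition cut C v := #|` seg (XC C) (2 ^ v)|.

(** The swap of [a] and [b] maps the points on [C :\ a] injectively to points on [C :\ b]; the
    hypotheses ensure that vertices below [u] move to vertices below [v]. *)
Lemma cut_le C a b u v : a \in C -> b \in C ->
  (forall j t, 0 < t -> j != a -> j != b -> vtx j t < u -> vtx j t < v) ->
  (forall t, 0 < t -> a != b -> vtx b t < u -> vtx a t < v) ->
  (a = b -> u <= v) ->
  cut (C :\ a) u <= cut (C :\ b) v.
Proof.
move=> aC bC hj hab hu.
rewrite /cut -(card_ren (tperm a b)); apply: fsubset_leq_card.
apply/fsubsetP=> _ /imfsetP[x /= + ->]; rewrite !in_seg => /andP[xC /key_ltP xu].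
rewrite -(tperm_preim aC bC) XC_ren xC /=; apply/key_ltP => j.
have xa : x a = 0 by apply: XC_zero xC _; rewrite !inE eqxx.
rewrite ffunE; case: tpermP => [ja|jb|/eqP ja /eqP jb] xj.
- case: (eqVneq a b) xj => [<-|ab xb]; first by rewrite xa.
  by rewrite ja; apply: hab => //; [rewrite lt0n | apply: xu].
- by rewrite xa in xj.
- by apply: hj => //; [rewrite lt0n | apply: xu].
Qed.

(** These are lengths of blocks of the order on [XC C], so this is the monotonicity [b_mono]
    required of block lengths. *)
Lemma cut_mono C a b (s t : nat) : a \in C -> b \in C -> 0 < s -> 0 < t ->
  vtx a s <= vtx b t -> cut (C :\ a) (vtx a s) <= cut (C :\ b) (vtx b t).
Proof.
move=> aC bC s0 t0 le; apply: cut_le => // [j r _ _ _ h|r r0 ab h].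
  exact: leq_trans h le.
have rs : r <= s.
  case: s s0 le h => [//|s] _ _ h; case: r r0 h => [//|r] _ h.
  by case: (leqP r s) => // lt; have := vtx_lt a b lt; lia.
have : vtx a r <= vtx a s by apply: vtx_le.
move=> h2; rewrite ltn_neqAle (leq_trans h2 le) andbT.
by apply: contraNneq ab => e; have [-> _] := vtx_inj r0 t0 e.
Qed.

Lemma cut_le_color C e b t : e \in C -> b \in C -> 0 < t ->
  cut (C :\ e) (vtx b t) <= cut (C :\ b) (vtx b t).
Proof.
move=> eC bC t0; apply: cut_le => // r r0 eb.
case: t t0 => [//|t] _; case: r r0 => [//|r] _.
by rewrite /vtx ltn_add2r ltn_mul2l /= => /andP[_ rt]; apply: (vtx_lt e b rt).
Qed.

End Faces.

(** * Splitting off the layer of a vertex *)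

Section Layers.

Variable n : nat.
Local Notation pt := {ffun 'I_n -> nat}.
Implicit Types (x y z : pt) (i j c : 'I_n) (C : {set 'I_n}) (D I L S : {fset pt}).

Definition del c t D : {fset pt} := [fset x in D | x c != t].

Lemma in_del c t D x : (x \in del c t D) = (x \in D) && (x c != t).
Proof. by rewrite !inE. Qed.

Lemma sum_del_lay c t D (F : pt -> nat) :
  \sum_(x <- D) F x =
  \sum_(x <- del c t D) F x + \sum_(y <- lay c t D) F (upd y c t).
Proof.
rewrite lay_sum (bigID (fun x => x c == t)) /= addnC; congr (_ + _).
by rewrite big_fset_condE.
Qed.

Lemma card_del_lay c t D : #|` D| = #|` del c t D| + #|` lay c t D|.
Proof. by rewrite !card_fset_sum1 (sum_del_lay c t D (fun=> 1)). Qed.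

Lemma weight_del_lay c t D : 0 < t ->
  weight D = weight (del c t D) + (weight (lay c t D) + #|` lay c t D|).
Proof.
move=> t0; rewrite /weight (sum_del_lay c t) card_fset_sum1 -big_split /=.
congr (_ + _); rewrite !big_seq; apply: eq_bigr => y.
by rewrite in_lay supp_updS // cardsU1 in_supp addnC => /andP[->].
Qed.

(** A spanned point whose entry at [c] is not [t] has all its facets outside the layer. If the entry
    is [t], forgetting [c] gives a point spanned by the layer. The requirement on the facet zeroing
    [c] is dropped, hence only an inequality. *)
Lemma spn_del_lay C c t D : 2 < #|C| -> c \in C -> 0 < t ->
  spn C D <= spn C (del c t D) + spn (C :\ c) (lay c t D).
Proof.
move=> C3 cC t0; have C2 : 1 < #|C :\ c| by rewrite (cardsD1 c) cC in C3.
rewrite /spn (card_del_lay c t); apply: leq_add; apply: fsubset_leq_card.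
  apply/fsubsetP=> x; rewrite in_del => /andP[/(SupP _ _ (ltnW C3))[xC xD] xc].
  apply/(SupP _ _ (ltnW C3)); split=> // i iC; rewrite in_del xD //= updE.
  by case: (c =P i) => // _; rewrite eq_sym -lt0n.
apply/fsubsetP=> y; rewrite in_lay => /andP[/eqP yc /(SupP _ _ (ltnW C3))[xC xD]].
apply/(SupP _ _ C2); split=> [|i].
  by have := PC_upd0 c xC; rewrite updK upd_id.
rewrite !inE => /andP[ic iC]; have ci : c != i by rewrite eq_sym.
by rewrite in_lay (upd_neq _ _ ci) yc /= (updC _ _ _ ic) xD.
Qed.

(** The reverse of [spn_del_lay]: the facet zeroing [c] of a new spanned point is a point spanned by
    [L], which the last hypothesis puts in [D]. *)
Lemma spn_join C c t D L : 2 < #|C| -> c \in C -> 0 < t ->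
  (forall x, x \in D -> x c != t) -> L `<=` D ->
  (forall y, y \in L -> y c = 0) -> (forall y, y \in Sup (C :\ c) L -> y \in D) ->
  spn C D + spn (C :\ c) L <= spn C (D `|` put c t L).
Proof.
move=> C3 cC t0 Dc LD Lc SD; have C2 : 1 < #|C :\ c| by rewrite (cardsD1 c) cC in C3.
have Sc y : y \in Sup (C :\ c) L -> y c = 0.
  by case/(SupP _ _ C2) => /PC_zero-> //; rewrite !inE eqxx.
rewrite /spn -addnC.
have -> : #|` Sup (C :\ c) L| = #|` put c t (Sup (C :\ c) L)|.
  by rewrite !card_fset_sum1 (put_sum _ (fun=> 1)).
rewrite addnC -cardfsUI [X in _ + X](_ : _ = 0) ?addn0; last first.
  apply/eqP; rewrite cardfs_eq0; apply/eqP/fsetP=> x; rewrite in_fsetI in_put // inE.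
  apply/negbTE; rewrite !negb_and -implybE; apply/implyP.
  case/(SupP _ _ (ltnW C3)) => xC xD; have [j jC jc] := other_elt c (ltnW C3).
  have cj : c != j by rewrite eq_sym.
  by have := Dc _ (xD j jC); rewrite (upd_neq _ _ cj) => ->.
apply: fsubset_leq_card; apply/fsubsetP=> x; rewrite in_fsetU.
case/orP=> [|].
  case/(SupP _ _ (ltnW C3)) => xC xD; apply/(SupP _ _ (ltnW C3)); split=> // i iC.
  by rewrite in_fsetU xD.
rewrite in_put // => /andP[/eqP xc yS]; have /(SupP _ _ C2)[yC yL] := yS.
have xE : x = upd (upd x c 0) c t by rewrite updK upd_id.
apply/(SupP _ _ (ltnW C3)); split=> [|i iC].
  by rewrite xE; apply: PC_upd.
rewrite in_fsetU; case: (eqVneq i c) => [->|ic].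
  by rewrite SD.
have ci : c != i by rewrite eq_sym.
rewrite in_put // (upd_neq _ _ ci) xc eqxx /= (updC _ _ _ ic) yL ?orbT //.
by rewrite !inE ic.
Qed.

(* The points of [XC C] with last vertex [vtx c t] come consecutively, and
   deleting that vertex turns them into an initial segment of [XC (C :\ c)]. *)
Lemma seg_block C c t u (v := vtx c t) : 1 < #|C :\ c| -> c \in C -> 0 < t ->
  u <= cut (C :\ c) v ->
  let I := seg (XC C) (2 ^ v) `|` put c t (Iseg (XC (C :\ c)) u) in
  [/\ initial (XC C) I, #|` I| = cut C v + u,
      del c t I = seg (XC C) (2 ^ v) & lay c t I = Iseg (XC (C :\ c)) u].
Proof.
move=> C2 cC t0 uv; set L := Iseg _ u => I.
have hL : initial (XC (C :\ c)) L by apply: Iseg_initial.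
have cL : #|` L| = u by apply: card_Iseg_XC.
have Lv y : y \in L -> XC (C :\ c) y /\ key y < 2 ^ v.
  have /fsubsetP s : L `<=` seg (XC (C :\ c)) (2 ^ v).
    by apply: (initial_sub hL); [eexists | rewrite cL].
  by move=> /s; rewrite in_seg => /andP[].
have Lc y : y \in L -> y c = 0.
  by case/Lv => /XC_zero-> //; rewrite !inE eqxx.
have segc x : x \in seg (XC C) (2 ^ v) -> x c != t.
  rewrite in_seg => /andP[_ /key_ltP h]; apply/eqP => xc.
  by have := h c; rewrite xc -lt0n t0 ltnn => /(_ isT).
have dI : del c t I = seg (XC C) (2 ^ v).
  apply/fsetP=> x; rewrite in_del in_fsetU in_put //.
  by apply/andP/idP => [[/orP[//|/andP[->//]]]|xs]; rewrite xs segc.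
have lI : lay c t I = L.
  apply/fsetP=> y; rewrite in_lay in_fsetU in_put // upd_eq eqxx updK /=.
  apply/andP/idP => [[/eqP yc /orP[/segc|]]|yL]; first by rewrite upd_eq eqxx.
    by rewrite upd_id.
  by rewrite (upd_id (Lc y yL)) yL orbT Lc.
split=> //; last by rewrite (card_del_lay c t) dI lI cL.
have Iup x : x \in put c t L -> XC C x /\ 2 ^ v <= key x < 2 ^ v + 2 ^ v.
  rewrite in_put // => /andP[/eqP xc /[dup] yL /Lv[yC yv]].
  have e : key x = 2 ^ v + key (upd x c 0).
    by rewrite -{1}(upd_id xc) key_upd -lt0n t0 mul1n.
  split; last by rewrite e leq_addr ltn_add2l.
  by rewrite -(upd_id xc) -(updK x c 0 t); apply: XC_upd.
apply: initialP => [x|x y]; rewrite in_fsetU.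
  by case/orP=> [|/Iup[]//]; rewrite in_seg => /andP[].
move=> xI yC yx; rewrite in_fsetU in_seg yC /=; case: ltnP => //= vy.
have : x \in put c t L.
  by case/orP: xI => //; rewrite in_seg => /andP[_]; rewrite ltnNge (leq_trans vy (ltnW yx)).
move=> xL; have [_ /andP[_ xv]] := Iup x xL.
(* A key from [2 ^ v] up to but excluding [2 ^ v.+1] belongs to a point with last vertex [v], which
   forces the entry [t] at [c]. *)
have yv : key y < 2 ^ v.+1 by rewrite expnS mul2n -addnn (ltn_trans yx).
have yc : y c = t.
  move/key_ltP: (yv) => h; apply/eqP; apply: contraTT vy => yct.
  rewrite -ltnNge; apply/key_ltP => j yj; have := h j yj; rewrite ltnS leq_eqVlt.
  case/orP=> // /eqP e; rewrite -lt0n in yj; have [jc e2] := vtx_inj yj t0 e.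
  by rewrite -jc e2 eqxx in yct.
move: xL; rewrite !in_put // yc eqxx => /andP[/eqP xc xL] /=.
apply: (initial_closed hL xL); last by rewrite ltnW // key_lt_upd // xc yc.
by apply: XC_upd0 => //; rewrite yc -lt0n.
Qed.

(** This is the block equation [fE]; the extra [u] counts the vertex at [c] in each of the [u]
    points. *)
Lemma fmax_block C c t u (v := vtx c t) : 1 < #|C :\ c| -> c \in C -> 0 < t ->
  u <= cut (C :\ c) v ->
  fmax C (cut C v + u) = fmax C (cut C v) + (fmax (C :\ c) u + u).
Proof.
move=> C2 cC t0 uv; have C1 : 1 < #|C| by rewrite (cardsD1 c) cC; apply: leqW.
have [hI cI dI lI] := seg_block C2 cC t0 uv.
have e : Iseg (XC C) (cut C v + u) = seg (XC C) (2 ^ v) `|` put c t (Iseg (XC (C :\ c)) u).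
  by apply: (initial_eq (Iseg_initial _ _) hI); rewrite cI card_Iseg_XC.
have e2 : Iseg (XC C) (cut C v) = seg (XC C) (2 ^ v).
  by apply: (initial_eq (Iseg_initial _ _)); [eexists | rewrite card_Iseg_XC].
rewrite /fmax e e2 (weight_del_lay c _ t0) dI lI.
by rewrite card_Iseg_XC.
Qed.

Lemma rmax_block C c t u (v := vtx c t) : 1 < #|C :\ c| -> c \in C -> 0 < t ->
  u <= cut (C :\ c) v ->
  rmax C (cut C v + u) = rmax C (cut C v) + rmax (C :\ c) u.
Proof.
move=> C2 cC t0 uv; have C3 : 2 < #|C| by rewrite (cardsD1 c) cC.
have [hI cI dI lI] := seg_block C2 cC t0 uv.
have e : Iseg (XC C) (cut C v + u) = seg (XC C) (2 ^ v) `|` put c t (Iseg (XC (C :\ c)) u).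
  by apply: (initial_eq (Iseg_initial _ _) hI); rewrite cI card_Iseg_XC // ltnW.
have e2 : Iseg (XC C) (cut C v) = seg (XC C) (2 ^ v).
  by apply: (initial_eq (Iseg_initial _ _)); [eexists | rewrite card_Iseg_XC // ltnW].
rewrite /rmax e e2; apply/eqP; rewrite eqn_leq; apply/andP; split.
  by have := spn_del_lay (seg (XC C) (2 ^ v) `|` put c t (Iseg (XC (C :\ c)) u)) C3 cC t0;
     rewrite dI lI.
have hL := Iseg_initial (XC (C :\ c)) u.
have Lv y : y \in Iseg (XC (C :\ c)) u -> XC (C :\ c) y /\ key y < 2 ^ v.
  have /fsubsetP s : Iseg (XC (C :\ c)) u `<=` seg (XC (C :\ c)) (2 ^ v).
    by apply: (initial_sub hL); [eexists | rewrite card_Iseg_XC].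
  by move=> /s; rewrite in_seg => /andP[].
have Lc y : y \in Iseg (XC (C :\ c)) u -> y c = 0.
  by case/Lv => /XC_zero-> //; rewrite !inE eqxx.
apply: spn_join => // [x||y].
- rewrite in_seg => /andP[_ /key_ltP h]; apply/eqP => xc.
  by have := h c; rewrite xc -lt0n t0 ltnn => /(_ isT).
- by apply/fsubsetP=> y /Lv[yC yv]; rewrite in_seg yv (XC_D1 cC yC).
(* A point spanned by the layer has only vertices below [v], since each of its coordinates survives
   in a facet belonging to the layer. *)
case/(SupP _ _ C2) => yC yL; rewrite in_seg; apply/andP; split.
  by rewrite /XC (eqP yC) properD1.
apply/key_ltP => j yj; have jC : j \in C :\ c by rewrite -(eqP yC) in_supp.
have [k kC kj] := other_elt j C2; have [_ /key_ltP h] := Lv _ (yL k kC).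
have jk : j != k by rewrite eq_sym.
by have := h j; rewrite (upd_neq _ _ jk); apply.
Qed.

End Layers.

(** * Regularity of the extremal functions *)

Section Cuts.

Variable n : nat.
Hypothesis n_gt0 : 0 < n.
Local Notation pt := {ffun 'I_n -> nat}.
Implicit Types (x y z : pt) (i j c : 'I_n) (C : {set 'I_n}) (D I L S : {fset pt}).

Lemma key_lt_pow_del x c t : 0 < t -> x c != t ->
  (key x < 2 ^ (vtx c t).+1) = (key x < 2 ^ vtx c t).
Proof.
move=> t0 xct; apply/idP/idP => [/key_ltP h|/ltn_trans]; last first.
  by apply; rewrite ltn_exp2l.
apply/key_ltP => j xj; have := h j xj; rewrite ltnS leq_eqVlt.
case/orP=> // /eqP e; rewrite -lt0n in xj; have [jc e2] := vtx_inj xj t0 e.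
by rewrite -jc e2 eqxx in xct.
Qed.

(** Zeroing the last vertex identifies the block of [vtx c t] with the points on [C :\ c] whose
    vertices are all smaller; this gives the block length. *)
Lemma cutS_in C c t : c \in C -> 0 < t ->
  cut C (vtx c t).+1 = cut C (vtx c t) + cut (C :\ c) (vtx c t).
Proof.
move=> cC t0; rewrite /cut (card_del_lay c t); congr (_ + _); apply: (congr1 (fun S : {fset pt} => #|` S|)); apply/fsetP=> x.
  rewrite in_del !in_seg; apply/idP/idP => [/andP[/andP[-> h] xc]|/andP[-> h]] /=.
    by rewrite -key_lt_pow_del.
  rewrite (ltn_trans h) ?ltn_exp2l //=; apply/eqP => xc.
  by move/key_ltP: h => /(_ c); rewrite xc -lt0n t0 ltnn => /(_ isT).
rewrite in_lay !in_seg key_upd -lt0n t0 mul1n expnS mul2n -addnn ltn_add2l.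
apply/idP/idP => [/andP[/eqP xc /andP[xC]]|/andP[xC]].
  rewrite upd_id // => ->; rewrite andbT.
  rewrite -[x](upd_id xc) -(updK x c t 0); apply: XC_upd0 => //.
  by rewrite upd_eq -lt0n.
have xc : x c = 0 by apply: (XC_zero xC); rewrite !inE eqxx.
by rewrite (upd_id xc) xc eqxx /= => ->; rewrite XC_upd.
Qed.

Lemma cutS_out C c t : c \notin C -> 0 < t -> cut C (vtx c t).+1 = cut C (vtx c t).
Proof.
move=> cC t0; rewrite /cut; apply: (congr1 (fun S : {fset pt} => #|` S|)); apply/fsetP=> x; rewrite !in_seg.
case: (boolP (XC C x)) => //= xC; rewrite key_lt_pow_del //.
by rewrite (XC_zero xC cC) neq_ltn t0.
Qed.

Lemma seg_pow0 C : 0 < #|C| -> seg (XC C) (2 ^ 0) = [fset zpt n].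
Proof.
move=> C0; apply/fsetP=> x; rewrite in_seg inE; apply/andP/eqP => [[_]|->].
  move/key_ltP => h; apply/ffunP=> i; rewrite ffunE; apply/eqP.
  by apply: contraT => /h.
by split; [apply: XC_zpt | apply/key_ltP => i; rewrite ffunE].
Qed.

Lemma cut0 C : 0 < #|C| -> cut C 0 = 1.
Proof. by move=> C0; rewrite /cut seg_pow0 // cardfs1. Qed.

Lemma cut_unbounded C : 1 < #|C| -> forall m, exists v, m < cut C v.
Proof.
move=> C2 m; have [K eK] := Iseg_initial (XC C) m.+1; exists K.
rewrite -(card_Iseg_XC m.+1 C2) eK; apply: fsubset_leq_card.
apply/fsubsetP=> x; rewrite !in_seg => /andP[->] /ltn_trans -> //.
exact: ltn_expl.
Qed.

Lemma Iseg_XC0 C : 1 < #|C| -> Iseg (XC C) 0 = fset0.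
Proof. by move=> C2; apply/cardfs0_eq/card_Iseg_XC. Qed.

Lemma Iseg_XC1 C : 1 < #|C| -> Iseg (XC C) 1 = [fset zpt n].
Proof.
move=> C2; rewrite -(seg_pow0 (ltnW C2)); apply: (initial_eq (Iseg_initial _ _)).
  by eexists.
by rewrite card_Iseg_XC // [RHS](cut0 (ltnW C2)).
Qed.

Lemma fmax0 C : 1 < #|C| -> fmax C 0 = 0.
Proof. by move=> C2; rewrite /fmax Iseg_XC0 // /weight big_seq_fset0. Qed.

Lemma fmax1 C : 1 < #|C| -> fmax C 1 = 0.
Proof.
by move=> C2; rewrite /fmax Iseg_XC1 // /weight big_seq_fset1 supp_zpt cards0.
Qed.

Lemma spn_small C D : 1 < #|C| -> D `<=` [fset zpt n] -> spn C D = 0.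
Proof.
move=> C2 /fsubsetP Dz; apply/eqP; rewrite cardfs_eq0; apply/eqP/fsetP=> x.
rewrite [RHS]inE; apply/negbTE/negP => /(SupP _ _ C2)[xC xD].
have /card_gt0P[i iC] : 0 < #|C| by apply: ltnW.
have [j jC ji] := other_elt i C2.
have := Dz _ (xD i iC); rewrite inE => /eqP/(congr1 (fun z : pt => z j)).
rewrite (upd_neq _ _ ji) ffunE => /eqP; apply/negP.
by rewrite -in_supp (eqP xC).
Qed.

Lemma rmax0 C : 1 < #|C| -> rmax C 0 = 0.
Proof. by move=> C2; apply: spn_small => //; rewrite Iseg_XC0 // fsub0set. Qed.

Lemma rmax1 C : 1 < #|C| -> rmax C 1 = 0.
Proof. by move=> C2; apply: spn_small => //; rewrite Iseg_XC1. Qed.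

(** The properties [gS] and [gI] of the block argument, carried through the induction on the number
    of coordinates. The lengths [cut C v] are the block lengths that occur with one coordinate
    more. *)
Definition regular C (h : nat -> nat) :=
  (forall u s, h u + h s <= h (u + s)) /\
  (forall v q r, r <= q -> q <= cut C v ->
     h q + h (cut C v - r) <= h (cut C v) + h (q - r)).

(** The conclusion of [block_window]: a window no longer than a block and starting no earlier weighs
    at least as much as a prefix of that block. *)
Definition windowed C (h g : nat -> nat) :=
  forall c t m l, c \in C -> 0 < t -> cut C (vtx c t) <= m ->
    l <= cut (C :\ c) (vtx c t) -> h m + g l <= h (m + l).

Lemma regular_step C (h g : nat -> nat) : 1 < #|C| ->
  h 0 = 0 -> h 1 = 0 -> g 0 = 0 -> (forall c, c \in C -> regular (C :\ c) g) ->
  (forall c t u, c \in C -> 0 < t -> u <= cut (C :\ c) (vtx c t) ->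
     h (cut C (vtx c t) + u) = h (cut C (vtx c t)) + g u) ->
  regular C h /\ windowed C h g.
Proof.
move=> C2 h0 h1 g0 gR hE; have C0 : 0 < #|C| by apply: ltnW.
(* Every [v] is a vertex by [vtx_surj]; its block is empty when its coordinate lies outside [C]. *)
pose b v := cut C v.+1 - cut C v.
have bE v : (exists c t, [/\ c \in C, 0 < t, v = vtx c t & b v = cut (C :\ c) v]) \/
    b v = 0.
  have [c [t [t0 ->]]] := vtx_surj v n_gt0; rewrite /b.
  case: (boolP (c \in C)) => cC; last by right; rewrite cutS_out // subnn.
  by left; exists c, t; rewrite cutS_in // addKn.
have cutS v : cut C v.+1 = cut C v + b v.
  rewrite /b subnKC //; have [c [t [t0 ->]]] := vtx_surj v n_gt0.
  by case: (boolP (c \in C)) => cC; [rewrite cutS_in // leq_addr | rewrite cutS_out].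
have gS : forall u s, g u + g s <= g (u + s).
  by case/card_gt0P: C0 => c /gR[].
have gI v q r : r <= q -> q <= b v -> g q + g (b v - r) <= g (b v) + g (q - r).
  case: (bE v) => [[c [t [cC t0 _ ->]]]|->]; first by case: (gR c cC) => _; apply.
  by rewrite leqn0 => rq /eqP q0; move: rq; rewrite q0 leqn0 => /eqP->.
have b_mono v w : v <= w -> 0 < b w -> b v <= b w.
  case: (bE v) => [[c [t [cC t0 -> ->]]]|->//].
  case: (bE w) => [[d [s [dC s0 -> ->]]]|->//] le _.
  exact: cut_mono.
have fE v u : u <= b v -> h (cut C v + u) = h (cut C v) + g u.
  case: (bE v) => [[c [t [cC t0 -> ->]]]|->]; first exact: hE.
  by rewrite leqn0 => /eqP->; rewrite g0 !addn0.
have unb := cut_unbounded C2.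
split; first split.
- exact: (block_superadditive g0 gS gI (cut0 C0) cutS b_mono unb h0 h1 fE).
- exact: (block_suffix g0 gS gI (cut0 C0) cutS b_mono unb h0 h1 fE).
move=> c t m l cC t0 cm lc.
have bc : b (vtx c t) = cut (C :\ c) (vtx c t) by rewrite /b cutS_in // addKn.
rewrite -bc in lc.
exact: (block_window g0 gS gI (cut0 C0) cutS b_mono unb h0 h1 fE cm lc).
Qed.

Lemma regular_ext C g g' : g =1 g' -> regular C g -> regular C g'.
Proof. by move=> e [hS hI]; split=> *; rewrite -!e; [apply: hS | apply: hI]. Qed.

Lemma regular_addn C g : regular C g -> regular C (fun u => g u + u).
Proof.
case=> hS hI; split=> [u s|v q r rq qv]; first by have := hS u s; lia.
by have := hI v q r rq qv; lia.
Qed.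

(** The block argument needs one sequence [g] of which all blocks are prefixes, whatever coordinate
    is removed; [extremal_max_eq] provides it. *)
Lemma regular_max C : 2 < #|C| ->
  (forall c, c \in C -> [/\ extremal (C :\ c), regular (C :\ c) (fmax (C :\ c)) &
                            regular (C :\ c) (rmax (C :\ c))]) ->
  forall c, c \in C ->
  [/\ regular C (fmax C), windowed C (fmax C) (fun u => fmax (C :\ c) u + u),
      regular C (rmax C) & windowed C (rmax C) (rmax (C :\ c))].
Proof.
move=> C3 H c cC; have C2 := ltnW C3.
have C2c d : d \in C -> 1 < #|C :\ d| by move=> dC; rewrite (cardsD1 d) dC in C3.
have E d : d \in C -> fmax (C :\ d) =1 fmax (C :\ c) /\ rmax (C :\ d) =1 rmax (C :\ c).
  by move=> dC; apply: (extremal_max_eq C3) => //; [case: (H d) | case: (H c)].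
have [h1 h2] : regular C (fmax C) /\ windowed C (fmax C) (fun u => fmax (C :\ c) u + u).
  apply: (regular_step C2 (fmax0 C2) (fmax1 C2)); first by rewrite fmax0 ?C2c.
    move=> d dC; have [e _] := E d dC; have [_ r _] := H d dC.
    by apply: (regular_ext _ (regular_addn r)) => u; rewrite e.
  move=> d t u dC t0 ud; have [e _] := E d dC.
  by rewrite -e; apply: fmax_block => //; apply: C2c.
have [h3 h4] : regular C (rmax C) /\ windowed C (rmax C) (rmax (C :\ c)).
  apply: (regular_step C2 (rmax0 C2) (rmax1 C2)); first by rewrite rmax0 ?C2c.
    move=> d dC; have [_ e] := E d dC; have [_ _ r] := H d dC.
    by apply: (regular_ext _ r) => u; rewrite e.
  move=> d t u dC t0 ud; have [_ e] := E d dC.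
  by rewrite -e; apply: rmax_block => //; apply: C2c.
by split.
Qed.

End Cuts.

(** * Two coordinates *)

(** The largest product of two natural numbers with sum [k]. *)
Definition halfprod k := k./2 * uphalf k.

Lemma halfprodS k : halfprod k.+1 = halfprod k + uphalf k.
Proof. by rewrite /halfprod uphalfE /= mulnS mulnC addnC. Qed.

Lemma leq_halfprod a b : a * b <= halfprod (a + b).
Proof.
wlog ab : a b / a <= b.
  by move=> h; case: (leqP a b) => [/h//|/ltnW/h]; rewrite mulnC addnC.
rewrite /halfprod; set u := _./2; set v := uphalf _.
have au : a <= u by rewrite /u; lia.
have uv : u <= v by rewrite /u /v; lia.
have -> : b = v + (u - a) by rewrite /u /v in au *; lia.
by rewrite -{2}(subnKC au); nia.
Qed.

Lemma halfprod_balanced a b : a <= b.+1 -> b <= a.+1 -> halfprod (a + b) = a * b.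
Proof.
move=> ab ba; rewrite /halfprod.
have [e|[e|e]] : a = b \/ a = b.+1 \/ b = a.+1 by lia.
- rewrite e; have -> : uphalf (b + b) = b by lia.
  by have -> : (b + b)./2 = b by lia.
- rewrite e; have -> : uphalf (b.+1 + b) = b.+1 by lia.
  have -> : (b.+1 + b)./2 = b by lia.
  exact: mulnC.
- rewrite e; have -> : uphalf (a + a.+1) = a.+1 by lia.
  by have -> : (a + a.+1)./2 = a by lia.
Qed.

Section TwoColors.

Variable n : nat.
Local Notation pt := {ffun 'I_n -> nat}.
Implicit Types (x y z : pt) (i j c : 'I_n) (C : {set 'I_n}) (D I L S : {fset pt}).

Lemma upd_zpt_inj i : injective (upd (zpt n) i).
Proof. by move=> s t /(congr1 (fun x : pt => x i)); rewrite !upd_eq. Qed.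

Lemma down_axis D i x0 : down D -> x0 \in D ->
  exists a, forall t, (upd (zpt n) i t \in D) = (t <= a).
Proof.
move=> dD x0D; have zD : upd (zpt n) i 0 \in D.
  by apply: dD x0D _ => j; rewrite updE; case: (j == i); rewrite ?ffunE.
have bnd t : upd (zpt n) i t \in D -> t <= \max_(x <- D) key x.
  move=> tD; rewrite -(upd_eq (zpt n) i t); apply: leq_trans (coord_le_key _ _) _.
  exact: (@leq_bigmax_seq _ _ _ (@key n)) tD _.
case: (ex_maxnP (ex_intro _ 0 zD) bnd) => a aD amax; exists a => t.
apply/idP/idP => [|ta]; first exact: amax.
by apply: dD aD _ => j; rewrite !updE; case: (j == i).
Qed.

Lemma XC2_axis (a b : 'I_n) x : a != b -> XC [set a; b] x ->
  (x = upd (zpt n) a (x a) /\ x b = 0) \/ (x = upd (zpt n) b (x b) /\ x a = 0).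
Proof.
move=> ab xC; have xz j : j != a -> j != b -> x j = 0.
  by move=> ja jb; apply: (XC_zero xC); rewrite !inE negb_or ja.
have : (x a == 0) || (x b == 0).
  apply: contraLR xC; rewrite negb_or -!in_supp => /andP[xa xb].
  by rewrite /XC properE subUset !sub1set xa xb andbF.
case/orP=> /eqP e; [right|left]; split=> //; apply/ffunP=> j; rewrite updE ffunE.
  by case: (eqVneq j b) => [->//|jb]; case: (eqVneq j a) => [->//|ja]; apply: xz.
by case: (eqVneq j a) => [->//|ja]; case: (eqVneq j b) => [->//|jb]; apply: xz.
Qed.

Lemma XC2 (a b : 'I_n) t : a != b ->
  XC [set a; b] (upd (zpt n) a t) /\ XC [set a; b] (upd (zpt n) b t).
Proof.
by move=> ab; split; apply: XC_single; rewrite ?cards2 ?ab // !inE eqxx ?orbT.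
Qed.

Lemma card_fset_ord (T : choiceType) k (F : 'I_k -> T) : injective F ->
  #|` [fset F t | t in 'I_k]| = k.
Proof. by move=> Fi; rewrite card_imfset //= -cardE card_ord. Qed.

(** Such a down-set consists of the origin, [p] further points on one axis and [q] on the other;
    each pair of nonzero points on different axes spans one point. *)
Lemma two_color_shape (a b : 'I_n) D x0 : a != b -> down D -> x0 \in D ->
  (forall x, x \in D -> XC [set a; b] x) ->
  exists p q, [/\ forall t, (upd (zpt n) a t \in D) = (t <= p),
    forall t, (upd (zpt n) b t \in D) = (t <= q),
    #|` D| = (p + q).+1, weight D = p + q & spn [set a; b] D = p * q].
Proof.
move=> ab dD x0D DC; have [p hp] := down_axis a dD x0D; have [q hq] := down_axis b dD x0D.
have C2 : 1 < #|[set a; b]| by rewrite cards2 ab.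
exists p, q; pose F (t : 'I_p) := upd (zpt n) a t.+1; pose G (t : 'I_q) := upd (zpt n) b t.+1.
have Finj : injective F by move=> s t /upd_zpt_inj[]/val_inj.
have Ginj : injective G by move=> s t /upd_zpt_inj[]/val_inj.
have zD : zpt n \in D by have := hp 0; rewrite upd_id ?ffunE.
have ba : b != a by rewrite eq_sym.
have DE : D `\ zpt n = [fset F t | t in 'I_p] `|` [fset G t | t in 'I_q].
  apply/fsetP=> x; rewrite in_fsetD1 in_fsetU; apply/andP/orP => [[xz xD]|].
    case: (XC2_axis ab (DC x xD)) => [[xE xb]|[xE xa]]; [left|right]; apply/imfsetP.
      have xa0 : 0 < x a.
        by rewrite lt0n; apply: contra xz => /eqP e; rewrite xE e upd_id ?ffunE.
      have xp : (x a).-1 < p by rewrite prednK // -hp -xE.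
      by exists (Ordinal xp) => //; rewrite /F /= prednK.
    have xb0 : 0 < x b.
      by rewrite lt0n; apply: contra xz => /eqP e; rewrite xE e upd_id ?ffunE.
    have xp : (x b).-1 < q by rewrite prednK // -hq -xE.
    by exists (Ordinal xp) => //; rewrite /G /= prednK.
  case=> /imfsetP[t _ ->]; split; rewrite ?hp ?hq //.
    by apply/eqP => /(congr1 (fun x : pt => x a)); rewrite upd_eq ffunE.
  by apply/eqP => /(congr1 (fun x : pt => x b)); rewrite upd_eq ffunE.
have cD : #|` D `\ zpt n| = p + q.
  rewrite DE cardfsU !card_fset_ord // [X in _ - X](_ : _ = 0) ?subn0 //.
  apply/eqP; rewrite cardfs_eq0; apply/eqP/fsetP=> x; rewrite in_fsetI [RHS]inE.
  apply/negbTE/negP => /andP[/imfsetP[s _ ->] /imfsetP[t _]].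
  by move/(congr1 (fun x : pt => x a)); rewrite upd_eq (upd_neq _ _ ab) ffunE.
split=> //; first by rewrite (cardfsD1 (zpt n)) zD cD.
  rewrite /weight (big_fsetD1 _ zD) /= supp_zpt cards0 add0n -cD card_fset_sum1.
  rewrite !big_seq; apply: eq_bigr => x; rewrite in_fsetD1 => /andP[xz xD].
  apply/eqP; rewrite eqn_leq; apply/andP; split.
    by rewrite -ltnS; have := proper_card (DC x xD); rewrite cards2 ab.
  rewrite card_gt0; apply: contra xz => /eqP xs; apply/eqP/ffunP=> j.
  by rewrite ffunE; apply/eqP; apply: contraT; rewrite -in_supp xs inE.
pose H (st : 'I_p * 'I_q) := upd (F st.1) b st.2.+1.
have HE st : H st a = st.1.+1 /\ H st b = st.2.+1.
  by rewrite /H /F (upd_neq _ _ ab) !upd_eq.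
have Hinj : injective H.
  move=> [s t] [s' t'] e; have [] := HE (s, t); rewrite e /=.
  by case: (HE (s', t')) => -> -> /= [/val_inj->] [/val_inj->].
rewrite /spn [Sup _ _](_ : _ = [fset H st | st in {: 'I_p * 'I_q}]).
  by rewrite card_imfset //= -cardE card_prod !card_ord.
apply/fsetP=> x; apply/(SupP _ _ C2)/imfsetP => [[xC xD]|[st _ ->]].
  have xz j : j != a -> j != b -> x j = 0.
    by move=> ja jb; apply: (PC_zero xC); rewrite !inE negb_or ja.
  have xa : 0 < x a by rewrite lt0n -in_supp (eqP xC) !inE eqxx.
  have xb : 0 < x b by rewrite lt0n -in_supp (eqP xC) !inE eqxx orbT.
  have xp : (x a).-1 < p.
    rewrite prednK // -hp; apply: dD (xD b _) _ => [|j]; first by rewrite !inE eqxx orbT.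
    rewrite !updE ffunE; case: (eqVneq j a) => [->|//].
    by rewrite (negbTE ab).
  have xq : (x b).-1 < q.
    rewrite prednK // -hq; apply: dD (xD a _) _ => [|j]; first by rewrite !inE eqxx.
    rewrite !updE ffunE; case: (eqVneq j b) => [->|//].
    by rewrite (negbTE ba).
  exists (Ordinal xp, Ordinal xq) => //; apply/ffunP=> j.
  rewrite /H /F /= !prednK // !updE ffunE.
  by case: (eqVneq j b) => [->//|jb]; case: (eqVneq j a) => [->//|ja]; apply: xz.
split=> [|i].
  rewrite /PC; apply/eqP/setP=> j; rewrite in_supp /H /F !updE ffunE !inE.
  by case: (eqVneq j b) => [_|jb]; rewrite ?orbT //; case: (eqVneq j a).
rewrite !inE => /orP[] /eqP->.
  have -> : upd (H st) a 0 = upd (zpt n) b st.2.+1.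
    apply/ffunP=> j; rewrite /H /F !updE ffunE.
    by case: (eqVneq j a) => [->|]; rewrite ?(negbTE ab).
  by rewrite hq.
have -> : upd (H st) b 0 = upd (zpt n) a st.1.+1.
  apply/ffunP=> j; rewrite /H /F !updE ffunE.
  by case: (eqVneq j b) => [->|]; rewrite ?(negbTE ba).
by rewrite hp.
Qed.

Lemma max_two_colors (a b : 'I_n) m : a != b ->
  fmax [set a; b] m = m.-1 /\ rmax [set a; b] m = halfprod m.-1.
Proof.
move=> ab; have C2 : 1 < #|[set a; b]| by rewrite cards2 ab.
case: m => [|m]; first by rewrite fmax0 // rmax0.
set I := Iseg (XC [set a; b]) m.+1.
have hI : initial (XC [set a; b]) I by apply: Iseg_initial.
have cI : #|` I| = m.+1 by apply: card_Iseg_XC.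
have /fset0Pn[x0 x0I] : I != fset0 by rewrite -cardfs_gt0 cI.
have [p [q [hp hq c w s]]] :=
  two_color_shape ab (down_initial hI) x0I (fun x => @initial_pred _ _ _ x hI).
rewrite /fmax /rmax -/I w s; have -> : m = p + q by move: c; rewrite cI => -[].
(* The value [t.+2] on either axis comes after [t.+1] on the other, so in an initial segment [p] and
   [q] differ by at most one. *)
have bal (c1 c2 : 'I_n) t : XC [set a; b] (upd (zpt n) c2 t.+1) ->
    upd (zpt n) c1 t.+2 \in I -> upd (zpt n) c2 t.+1 \in I.
  move=> h1 h2; apply: (initial_closed hI h2 h1); apply/ltnW.
  by rewrite !key_single // ltn_exp2l // vtx_lt.
split=> //; rewrite halfprod_balanced //.
  case: (p) hp => [|[|k]] // hk; rewrite ltnS -hq.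
  by apply: (bal a); [case: (XC2 k.+1 ab) | rewrite hk].
case: (q) hq => [|[|k]] // hk; rewrite ltnS -hp.
by apply: (bal b); [case: (XC2 k.+1 ab) | rewrite hk].
Qed.

(** Base of the induction. The weight depends only on the size, the number of spanned points is
    bounded by the balanced product, and that product is convex in the size. *)
Lemma extremal_two_colors C : #|C| = 2 ->
  [/\ extremal C, regular C (fmax C) & regular C (rmax C)].
Proof.
move=> /eqP/cards2P[a [b [ab ->]]]; have C2 : 1 < #|[set a; b]| by rewrite cards2 ab.
have fE m := (max_two_colors m ab).1; have rE m := (max_two_colors m ab).2.
split.
- move=> D dD DC; rewrite fE rE; case: (fset_0Vmem D) => [->|[x0 x0D]].
    by rewrite cardfs0 /weight big_seq_fset0 spn_small // fsub0set.
  have [p [q [_ _ -> -> ->]]] := two_color_shape ab dD x0D DC.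
  by split=> //; apply: leq_halfprod.
- apply: (@regular_ext _ _ predn) => [m|]; first by rewrite fE.
  by split=> [u s|v q r rq qv]; lia.
pose h m := halfprod m.-1.
apply: (@regular_ext _ _ h) => [m|]; first by rewrite rE.
have hS k : h k <= h k.+1.
  by rewrite /h /=; case: k => //= k; rewrite halfprodS leq_addr.
have hc k : h k.+1 + h k.+1 <= h k + h k.+2.
  rewrite /h /=; case: k => //= k; rewrite !halfprodS.
  have : uphalf k <= uphalf k.+1 by lia.
  lia.
split=> [|v q r]; first exact: convex_superadditive.
exact: convex_suffix.
Qed.

End TwoColors.

(** * Compression *)

Section Compression.

Variable n : nat.
Local Notation pt := {ffun 'I_n -> nat}.
Implicit Types (x y z : pt) (i j c : 'I_n) (C : {set 'I_n}) (D I L S : {fset pt}).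

Definition sep (P : pred pt) S : {fset pt} := [fset y in S | P y].

Lemma in_sep P S y : (y \in sep P S) = (y \in S) && P y.
Proof. by rewrite !inE. Qed.

Variables (C : {set 'I_n}) (i : 'I_n) (D : {fset pt}).
Hypotheses (C3 : 2 < #|C|) (iC : i \in C) (extC : extremal (C :\ i)).
Hypotheses (downD : down D) (DC : forall x, x \in D -> XC C x).

Let C2 : 1 < #|C :\ i|.
Proof. by have := C3; rewrite (cardsD1 i) iC. Qed.

Let Q := sep (XC (C :\ i)) (lay i 0 D).
Let R := sep (PC (C :\ i)) (lay i 0 D).

(** In layer 0 the points [R], whose only zero in [C] is at [i], are not in [XC (C :\ i)]. They are
    replaced by an initial segment of full-support points, separately from the rest [Q]. *)
Definition clay t : {fset pt} :=
  if t is 0 then Iseg (XC (C :\ i)) #|` Q| `|` Iseg (PC (C :\ i)) #|` R|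
  else Iseg (XC (C :\ i)) #|` lay i t D|.

Let B := \max_(x <- D) x i.

Definition compress : {fset pt} := \bigcup_(t <- iota 0 B.+1) put i t (clay t).

Let D_le x : x \in D -> x i <= B.
Proof. by move=> xD; apply: (@leq_bigmax_seq _ _ _ (fun x : pt => x i)) xD _. Qed.

Let lay_big t : B < t -> lay i t D = fset0.
Proof.
move=> Bt; apply/fsetP=> y; rewrite in_lay [RHS]inE; apply/negbTE/negP.
by case/andP=> _ /D_le; rewrite upd_eq leqNgt Bt.
Qed.

Lemma clay_zero t y : y \in clay t -> y i = 0.
Proof.
have ii : i \notin C :\ i by rewrite !inE eqxx.
have hX m : y \in Iseg (XC (C :\ i)) m -> y i = 0.
  by move/(initial_pred (Iseg_initial _ _))/XC_zero; apply.
case: t => [|t] /=; last exact: hX.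
rewrite in_fsetU => /orP[/hX //|].
by move/(initial_pred (Iseg_initial _ _))/PC_zero; apply.
Qed.

Lemma in_compress x : (x \in compress) = (upd x i 0 \in clay (x i)).
Proof.
apply/bigfcupP/idP => [[t _]|xc].
  by rewrite in_put => [/andP[/eqP-> //]|y]; apply: clay_zero.
exists (x i); last by rewrite in_put ?eqxx // => y; apply: clay_zero.
(* Layers beyond [B] are empty, and so are their compressions. *)
rewrite mem_iota add0n leq0n andbT ltnS leqNgt /=; apply: contraL xc => Bx.
by case: (x i) Bx => // t Bt /=; rewrite lay_big // cardfs0 Iseg_XC0 // inE.
Qed.

Lemma lay_compress t : lay i t compress = clay t.
Proof.
apply/fsetP=> y; rewrite in_lay in_compress upd_eq updK.
apply/andP/idP => [[/eqP yi]|yt]; first by rewrite upd_id.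
by rewrite (upd_id (clay_zero yt)) (clay_zero yt) eqxx.
Qed.

Let compress_le x : x \in compress -> x i <= B.
Proof.
case/bigfcupP=> t; rewrite mem_iota add0n ltnS leq0n andbT => tB.
by rewrite in_put => [/andP[/eqP-> //]|y]; apply: clay_zero.
Qed.

Let lay0E : lay i 0 D = Q `|` R.
Proof.
apply/fsetP=> y; rewrite in_fsetU !in_sep -andb_orr.
case: (boolP (y \in lay i 0 D)) => //=; rewrite in_lay => /andP[/eqP yi].
rewrite (upd_id yi) => /DC yC; symmetry; rewrite /XC /PC properEneq.
have -> : supp y \subset C :\ i.
  by rewrite subsetD1 (proper_sub yC) in_supp yi eqxx.
by rewrite andbT orbC orbN.
Qed.

Let disjQR (S S' : {fset pt}) : (forall y, y \in S -> XC (C :\ i) y) ->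
  (forall y, y \in S' -> PC (C :\ i) y) -> S `&` S' = fset0.
Proof.
move=> hS hS'; apply/fsetP=> y; rewrite in_fsetI [RHS]inE; apply/negbTE/negP.
case/andP=> /hS h /hS' /eqP e; move: h; rewrite /XC e properE subxx.
by [].
Qed.

Let sumU (S S' : {fset pt}) (F : pt -> nat) : S `&` S' = fset0 ->
  \sum_(y <- S `|` S') F y = \sum_(y <- S) F y + \sum_(y <- S') F y.
Proof.
move=> SS; rewrite (big_fsetID _ (mem S)) /=; congr (_ + _); apply: eq_fbigl => y.
  by rewrite !inE; case: (y \in S); rewrite ?andbT ?andbF.
rewrite !inE; case: (boolP (y \in S)) => //= yS; rewrite ?andbT //.
by symmetry; apply/negbTE/negP => yS'; have := in_fsetI S S' y; rewrite SS yS yS' inE.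
Qed.

Let QC y : y \in Q -> XC (C :\ i) y.
Proof. by rewrite in_sep => /andP[]. Qed.
Let RC y : y \in R -> PC (C :\ i) y.
Proof. by rewrite in_sep => /andP[]. Qed.
Let IXC m y : y \in Iseg (XC (C :\ i)) m -> XC (C :\ i) y.
Proof. exact: (initial_pred (Iseg_initial _ _)). Qed.
Let IPC m y : y \in Iseg (PC (C :\ i)) m -> PC (C :\ i) y.
Proof. exact: (initial_pred (Iseg_initial _ _)). Qed.

Let cIX m : #|` Iseg (XC (C :\ i)) m| = m.
Proof. exact: card_Iseg_XC. Qed.
Let cIP m : #|` Iseg (PC (C :\ i)) m| = m.
Proof. exact: card_Iseg_PC (ltnW C2). Qed.

Let layXC t y : 0 < t -> y \in lay i t D -> XC (C :\ i) y.
Proof.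
move=> t0; rewrite in_lay => /andP[/eqP yi /DC yC].
rewrite -(upd_id yi) -(updK y i t 0); apply: XC_upd0 => //.
by rewrite upd_eq -lt0n.
Qed.

Lemma down_lay t : down (lay i t D).
Proof.
move=> x y; rewrite !in_lay => /andP[/eqP xi xD] yx.
have := yx i; rewrite xi leqn0 => ->; apply: downD xD _ => j.
by rewrite !updE; case: (j == i).
Qed.

Let downQ : down Q.
Proof.
move=> x y; rewrite !in_sep => /andP[xl xC] yx.
by rewrite (down_lay xl yx) (XC_le yx xC).
Qed.

Let lay_zero t y : y \in lay i t D -> y i = 0.
Proof. by rewrite in_lay => /andP[/eqP]. Qed.

Lemma card_clay t : #|` clay t| = #|` lay i t D|.
Proof.
case: t => [|t] /=; last exact: cIX.
have cardU (S S' : {fset pt}) : S `&` S' = fset0 -> #|` S `|` S'| = #|` S| + #|` S'|.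
  by move=> e; rewrite -cardfsUI e cardfs0 addn0.
by rewrite lay0E (cardU _ _ (disjQR QC RC)) (cardU _ _ (disjQR (@IXC _) (@IPC _))) cIX cIP.
Qed.

Lemma card_compress : #|` compress| = #|` D|.
Proof.
rewrite (card_fset_sum1 compress) (card_fset_sum1 D).
rewrite (sum_lays (fun=> 1) D_le) (sum_lays (fun=> 1) compress_le).
by apply: eq_bigr => t _; rewrite lay_compress -!card_fset_sum1 card_clay.
Qed.

Let weightPC (S : {fset pt}) : (forall y, y \in S -> PC (C :\ i) y) ->
  weight S = #|` S| * #|C :\ i|.
Proof.
move=> hS; rewrite /weight card_fset_sum1 big_distrl /= !big_seq.
by apply: eq_bigr => y /hS/eqP->; rewrite mul1n.
Qed.

(** Extremality of [C :\ i] applies to [Q] and to every layer with positive entry, while all points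
    of [R] have the same support size. *)
Lemma weight_compress : weight D <= weight compress.
Proof.
rewrite /weight (sum_lays _ D_le) (sum_lays _ compress_le).
apply: leq_sum => -[[|t] tB] _ /=; rewrite lay_compress /=.
  have e (S : {fset pt}) : (forall y, y \in S -> y i = 0) ->
      \sum_(y <- S) #|supp (upd y i 0)| = weight S.
    by move=> h; rewrite /weight !big_seq; apply: eq_bigr => y /h yi; rewrite upd_id.
  rewrite (e _ (@lay_zero 0)) (e _ (@clay_zero 0)).
  rewrite /weight lay0E !sumU; try exact: disjQR; last exact: disjQR (@IXC _) (@IPC _).
  rewrite -![\sum_(y <- _) #|supp y|]/(weight _).
  have [h _] := extC downQ QC; apply: leq_add h _.
  by rewrite (weightPC RC) (weightPC (@IPC _)) cIP.
have e (S : {fset pt}) : (forall y, y \in S -> y i = 0) ->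
    \sum_(y <- S) #|supp (upd y i t.+1)| = weight S + #|` S|.
  move=> h; rewrite /weight card_fset_sum1 -big_split /= !big_seq.
  apply: eq_bigr => y /h yi; rewrite supp_updS // cardsU1 in_supp yi /=.
  by rewrite addnC.
rewrite (e _ (@lay_zero t.+1)) (e _ (@clay_zero t.+1)).
rewrite cIX leq_add2r.
by have [h _] := extC (@down_lay t.+1) (fun y => @layXC t.+1 y isT).
Qed.

Lemma lay_Sup (S : {fset pt}) t : 0 < t -> lay i t (Sup C S) =
  sep (PC (C :\ i)) (lay i 0 S) `&` Sup (C :\ i) (lay i t S).
Proof.
move=> t0; apply/fsetP=> y; rewrite in_fsetI in_sep !in_lay; apply/andP/idP => [[/eqP yi /(SupP _ _ (ltnW C3))[yC yS]]|].
  have yC' : PC (C :\ i) y.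
    by have := PC_upd0 i yC; rewrite updK upd_id.
  have := yS i iC; rewrite updK yi eqxx yC' => -> /=.
  apply/(SupP _ _ C2); split=> // j; rewrite !inE => /andP[ji jC].
  have ij : i != j by rewrite eq_sym.
  by rewrite in_lay (upd_neq _ _ ij) yi eqxx (updC _ _ _ ji) yS.
case/andP=> /andP[/andP[/eqP yi y0] yC] /(SupP _ _ C2)[_ yS]; split; first by rewrite yi.
apply/(SupP _ _ (ltnW C3)); split=> [|j jC]; first exact: PC_upd.
case: (eqVneq j i) => [->|ji]; first by rewrite updK.
have /yS : j \in C :\ i by rewrite !inE ji.
by rewrite in_lay => /andP[_]; rewrite (updC _ _ _ ji).
Qed.

Let lay_Sup0 (S : {fset pt}) : lay i 0 (Sup C S) = fset0.
Proof.
apply/fsetP=> y; rewrite in_lay [RHS]inE; apply/negbTE/negP => /andP[/eqP yi].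
rewrite upd_id // => /(SupP _ _ (ltnW C3))[/eqP yC _].
by move: iC; rewrite -yC in_supp yi.
Qed.

Let Sup_le (S : {fset pt}) : (forall x, x \in S -> x i <= B) ->
  forall x, x \in Sup C S -> x i <= B.
Proof.
move=> hS x /(SupP _ _ (ltnW C3))[_ xS]; have [j jC ji] := other_elt i (ltnW C3).
have ij : i != j by rewrite eq_sym.
by have := hS _ (xS j jC); rewrite (upd_neq _ _ ij).
Qed.

(** By [lay_Sup] each positive layer of the spanned set is [R] intersected with the points spanned
    by the corresponding layer of [D]. After compression both are initial segments, hence nested, so
    the intersection is as large as the smaller of the two; neither of these sizes has decreased. *)
Lemma spn_compress : spn C D <= spn C compress.
Proof.
rewrite /spn !card_fset_sum1 (sum_lays _ (Sup_le D_le)) (sum_lays _ (Sup_le compress_le)).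
apply: leq_sum => -[[|t] tB] _ /=; rewrite -!card_fset_sum1 ?lay_Sup0 ?cardfs0 //.
rewrite !lay_Sup // !lay_compress -/R.
have -> : sep (PC (C :\ i)) (clay 0) = Iseg (PC (C :\ i)) #|` R|.
  apply/fsetP=> y; rewrite in_sep in_fsetU; apply/andP/idP => [[/orP[/IXC|//]]|yI].
    by rewrite /XC /PC => /[swap] /eqP->; rewrite properE subxx.
  by rewrite yI orbT; split=> //; apply: IPC yI.
have hS : initial (PC (C :\ i)) (Sup (C :\ i) (clay t.+1)).
  exact: Sup_initial (Iseg_initial _ _).
have hR := Iseg_initial (PC (C :\ i)) #|` R|.
have [_ hs] := extC (@down_lay t.+1) (fun y => @layXC t.+1 y isT).
case: (leqP #|` R| #|` Sup (C :\ i) (clay t.+1)|) => le.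
  have /fsetIidPl -> : Iseg (PC (C :\ i)) #|` R| `<=` Sup (C :\ i) (clay t.+1).
    by apply: (initial_sub hR hS); rewrite cIP.
  by rewrite cIP; apply: fsubset_leq_card; apply: fsubsetIl.
have /fsetIidPr -> : Sup (C :\ i) (clay t.+1) `<=` Iseg (PC (C :\ i)) #|` R|.
  by apply: (initial_sub hS hR); rewrite cIP ltnW.
by apply: leq_trans hs; apply: fsubset_leq_card; apply: fsubsetIr.
Qed.

Lemma compress_XC x : x \in compress -> XC C x.
Proof.
rewrite in_compress; case: (posnP (x i)) => [x0|x0].
  rewrite x0 upd_id // in_fsetU => /orP[/IXC|/IPC/eqP e].
    exact: XC_D1.
  by rewrite /XC e properD1.
case e : (x i) x0 => [//|t] _ /IXC /(XC_upd iC (ltn0Sn t)).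
by rewrite updK upd_id.
Qed.

Let lay_anti s t : s <= t -> lay i t D `<=` lay i s D.
Proof.
move=> st; apply/fsubsetP=> y; rewrite !in_lay => /andP[-> yD].
by apply: downD yD _ => j; rewrite !updE; case: (j == i).
Qed.

Let sub_clay s t : 0 < t -> s <= t -> Iseg (XC (C :\ i)) #|` lay i t D| `<=` clay s.
Proof.
move=> t0 st; have hL := Iseg_initial (XC (C :\ i)).
case: s st => [_|s st] /=.
  apply: fsubset_trans (fsubsetUl _ _); apply: (initial_sub (hL _) (hL _)).
  rewrite !cIX; apply: fsubset_leq_card; apply/fsubsetP=> y yt.
  by rewrite in_sep (fsubsetP (lay_anti (leq0n t))) //= (layXC t0).
by apply: (initial_sub (hL _) (hL _)); rewrite !cIX; apply/fsubset_leq_card/lay_anti.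
Qed.

Let R_spanned : Iseg (PC (C :\ i)) #|` R| `<=` Sup (C :\ i) (Iseg (XC (C :\ i)) #|` Q|).
Proof.
apply: (initial_sub (Iseg_initial _ _) (Sup_initial C2 (Iseg_initial _ _))).
rewrite cIP; have [_ h] := extC downQ QC; apply: leq_trans h.
apply: fsubset_leq_card; apply/fsubsetP=> y; rewrite in_sep => /andP[yl yC].
apply/(SupP _ _ C2); split=> // j jC; rewrite in_sep PC_facet // andbT.
by apply: down_lay yl _ => k; rewrite updE; case: (k == j).
Qed.

(** Between layers, the sizes decrease with the entry at [i] and initial segments are nested. Within
    layer 0, a point below a member of the new [R] either has the same support and precedes it, or
    lies below one of its facets, which [R_spanned] puts in the new [Q]. *)
Lemma down_compress : down compress.
Proof.
move=> x y; rewrite !in_compress => xc yx.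
have yx' j : upd y i 0 j <= upd x i 0 j by rewrite !updE; case: (j == i).
have dX m : down (Iseg (XC (C :\ i)) m) by apply: down_initial (Iseg_initial _ _).
case: (posnP (x i)) => [x0|x0].
  have y0 : y i = 0 by have := yx i; rewrite x0 leqn0 => /eqP.
  move: xc; rewrite x0 y0 /= !in_fsetU => /orP[/dX/(_ yx')->//|xR].
  case: (boolP (PC (C :\ i) (upd y i 0))) => yC.
    by rewrite (initial_closed (Iseg_initial _ _) xR yC (key_mono yx')) orbT.
  have /(SupP _ _ C2)[xC xQ] := fsubsetP R_spanned _ xR.
  have ys : supp (upd y i 0) \subset C :\ i by rewrite -(eqP xC) supp_mono.
  have [j jC yj] : exists2 j, j \in C :\ i & upd y i 0 j = 0.
    have : ~~ (C :\ i \subset supp (upd y i 0)).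
      by apply: contra yC => h; rewrite /PC eqEsubset ys.
    by case/subsetPn=> j jC; rewrite in_supp negbK => /eqP; exists j.
  apply/orP; left; apply: dX (xQ j jC) _ => k; rewrite [X in _ <= X]updE.
  by case: eqP => [->|_]; rewrite ?yj.
have xL : upd x i 0 \in Iseg (XC (C :\ i)) #|` lay i (x i) D| by case: (x i) x0 xc.
exact: (fsubsetP (sub_clay x0 (yx i))) (dX _ _ _ xL yx').
Qed.

Lemma key_sum_compress t : 0 < t -> ~ initial (XC (C :\ i)) (lay i t D) ->
  \sum_(x <- compress) key x < \sum_(x <- D) key x.
Proof.
move=> t0 nI; rewrite (sum_lays _ D_le) (sum_lays _ compress_le).
have tB : t < B.+1.
  rewrite ltnS leqNgt; apply/negP => /lay_big e; apply: nI; rewrite e.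
  by rewrite -(Iseg_XC0 C2); apply: Iseg_initial.
have split_key (S : {fset pt}) s : (forall y, y \in S -> y i = 0) ->
    \sum_(y <- S) key (upd y i s) = #|` S| * ((s != 0) * 2 ^ vtx i s) + \sum_(y <- S) key y.
  move=> h; rewrite card_fset_sum1 big_distrl -big_split /= !big_seq.
  by apply: eq_bigr => y /h yi; rewrite key_upd (upd_id yi) mul1n.
have le s : \sum_(y <- clay s) key (upd y i s) <= \sum_(y <- lay i s D) key (upd y i s).
  rewrite !split_key ?card_clay ?leq_add2l; [|exact: lay_zero|exact: clay_zero].
  case: s => [|s] /=; last first.
    have [] := initial_key_sum (fun y => @layXC s.+1 y isT) (Iseg_initial _ #|` lay i s.+1 D|) _.
      exact: cIX.
    by [].
  rewrite lay0E !sumU; [|exact: disjQR QC RC|exact: disjQR (@IXC _) (@IPC _)].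
  have [h1 _] := initial_key_sum QC (Iseg_initial _ #|` Q|) (cIX _).
  have [h2 _] := initial_key_sum RC (Iseg_initial _ #|` R|) (cIP _).
  exact: leq_add.
have lt : \sum_(y <- clay t) key (upd y i t) < \sum_(y <- lay i t D) key (upd y i t).
  rewrite !split_key ?card_clay ?ltn_add2l; [|exact: lay_zero|exact: clay_zero].
  case: t t0 nI {tB} => [//|t] _ nI /=.
  have [h1 h2] := initial_key_sum (fun y => @layXC t.+1 y isT) (Iseg_initial _ #|` lay i t.+1 D|) (cIX _).
  rewrite ltn_neqAle h1 h2 andbT; apply/eqP => e; apply: nI; rewrite -e.
  exact: Iseg_initial.
rewrite (bigD1 (Ordinal tB)) // [X in _ < X](bigD1 (Ordinal tB)) //=.
rewrite lay_compress -addSn; apply: leq_add => //.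
by apply: leq_sum => s _; rewrite lay_compress.
Qed.

End Compression.

(** * Compressed sets *)

Section Extremal.

Variable n : nat.
Hypothesis n_gt0 : 0 < n.
Local Notation pt := {ffun 'I_n -> nat}.
Implicit Types (x y z : pt) (i j c : 'I_n) (C : {set 'I_n}) (D I L S : {fset pt}).

Lemma block_at C m : 1 < #|C| -> 0 < m -> exists c t, [/\ c \in C, 0 < t &
  cut C (vtx c t) <= m < cut C (vtx c t).+1].
Proof.
move=> C2 m0; have C0 := ltnW C2; case: (ex_minnP (cut_unbounded C2 m)) => -[|v] mv vmin.
  by move: mv; rewrite cut0 // ltnNge m0.
have [c [t [t0 e]]] := vtx_surj v n_gt0; subst v; exists c, t.
have le : cut C (vtx c t) <= m by rewrite leqNgt; apply/negP => /vmin; rewrite ltnn.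
rewrite mv le; split=> //; apply: contraLR mv => cC.
by rewrite cutS_out // -leqNgt.
Qed.

Lemma top_vertex D x0 : x0 \in D -> x0 != zpt n -> exists x c,
  [/\ x \in D, x c != 0 &
      forall y j, y \in D -> y j != 0 -> vtx j (y j) <= vtx c (x c)].
Proof.
move=> x0D x0z.
have ex : exists N, [forall y : D, key (fsval y) < 2 ^ N].
  exists (\max_(x <- D) key x); apply/forallP => y.
  apply: leq_ltn_trans (ltn_expl _ (ltnSn 1)).
  exact: (@leq_bigmax_seq _ _ _ (@key n)) (valP y) _.
case: (ex_minnP ex) => -[|v] /forallP hN Nmin.
  case/negP: x0z; apply/eqP/ffunP=> j; rewrite ffunE; apply/eqP; apply: contraT => xj.
  by have /key_ltP/(_ j xj) := hN [` x0D].
have : ~~ [forall y : D, key (fsval y) < 2 ^ v] by apply/negP => /Nmin; rewrite ltnn.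
rewrite negb_forall => /existsP[x]; have xN := hN x => xv.
have [c /andP[xc le]] : exists c, (fsval x c != 0) && (v <= vtx c (fsval x c)).
  apply/existsP; apply: contraR xv; rewrite negb_exists => /forallP h.
  by apply/key_ltP => c xc; have := h c; rewrite xc -ltnNge.
exists (fsval x), c; split=> // y j yD yj.
by have /key_ltP/(_ j yj) := hN [` yD]; rewrite ltnS => /leq_trans; apply.
Qed.

Lemma compressed_bound C D :
  2 < #|C| ->
  (forall c, c \in C -> [/\ extremal (C :\ c), regular (C :\ c) (fmax (C :\ c)) &
                            regular (C :\ c) (rmax (C :\ c))]) ->
  (forall S, #|` S| < #|` D| -> down S -> (forall x, x \in S -> XC C x) ->
     weight S <= fmax C #|` S| /\ spn C S <= rmax C #|` S|) ->
  down D -> (forall x, x \in D -> XC C x) ->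
  (forall c t, c \in C -> 0 < t -> initial (XC (C :\ c)) (lay c t D)) ->
  weight D <= fmax C #|` D| /\ spn C D <= rmax C #|` D|.
Proof.
move=> C3 H IH dD DC layI; have C2 := ltnW C3; have C0 := ltnW C2.
have C2c d : d \in C -> 1 < #|C :\ d| by move=> dC; rewrite (cardsD1 d) dC in C3.
case: (boolP (D `<=` [fset zpt n])) => [Dz|/fsubsetPn[x0 x0D]]; last rewrite inE => x0z.
  rewrite spn_small // /weight big_seq big1 // => x /(fsubsetP Dz).
  by rewrite inE => /eqP->; rewrite supp_zpt cards0.
have [x1 [e [x1D x1e top]]] := top_vertex x0D x0z.
set t := x1 e in x1e top; have t0 : 0 < t by rewrite lt0n.
have eC : e \in C by apply: contraNT x1e => /(XC_zero (DC _ x1D)) h; apply/eqP.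
set L := lay e t D; set D' := del e t D; have cD := card_del_lay e t D.
have zD : zpt n \in D by apply: dD x1D _ => j; rewrite ffunE.
have zD' : zpt n \in D' by rewrite in_del zD ffunE eq_sym -lt0n.
have zL : zpt n \in L.
  rewrite in_lay ffunE eqxx /=; apply: dD x1D _ => j; rewrite updE ffunE.
  by case: (j =P e) => [->|].
have L0 : 0 < #|` L| by rewrite cardfs_gt0; apply/fset0Pn; exists (zpt n).
have D'0 : 0 < #|` D'| by rewrite cardfs_gt0; apply/fset0Pn; exists (zpt n).
(* No entry at [e] exceeds [t], so removing the points with entry [t] leaves a down-set. *)
have dD' : down D'.
  move=> x y; rewrite !in_del => /andP[xD xe] yx; rewrite (dD _ _ xD yx) /=.
  case: (posnP (x e)) => [xe0|xe0].
    by have := yx e; rewrite xe0 leqn0 => /eqP->; rewrite eq_sym -lt0n.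
  rewrite neq_ltn (leq_ltn_trans (yx e)) // ltn_neqAle xe /= leqNgt.
  apply/negP => lt; have := top x e xD; rewrite -lt0n => /(_ xe0).
  have := vtx_lt e e (_ : t.-1 < (x e).-1); rewrite !prednK //.
  by move=> h; rewrite leqNgt h //; lia.
have D'C x : x \in D' -> XC C x by rewrite in_del => /andP[/DC].
have [c [s [cC s0 /andP[cm mc]]]] := block_at C2 D'0; set v := vtx c s in cm mc.
have hL : initial (XC (C :\ e)) L := layI e t eC t0.
have Lb : #|` L| <= cut (C :\ c) v.
  (* Otherwise [L] contains all vertices up to [v] outside the direction [e], so
     [D] contains the edges joining them to the last vertex. As layers are initial,
     [D'] then contains all points with vertices up to [v], contradicting [mc]. *)
  rewrite leqNgt; apply/negP => bL.
  have Le : #|` L| <= cut (C :\ e) (vtx e t).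
    apply: fsubset_leq_card; apply/fsubsetP=> y yL; rewrite in_seg (initial_pred hL yL) /=.
    move: yL; rewrite in_lay => /andP[/eqP ye yD]; apply/key_ltP => j yj.
    have je : j != e by apply: contraNneq yj => ->; rewrite ye.
    have := top _ j yD; rewrite (upd_neq _ _ je) => /(_ yj).
    rewrite leq_eqVlt => /orP[/eqP h|//]; rewrite -lt0n in yj.
    by have [h' _] := vtx_inj yj t0 h; rewrite h' eqxx in je.
  (* If the last vertex were at most [v], monotonicity of block lengths would contradict [bL]. *)
  have ve : v < vtx e t.
    rewrite ltnNge; apply/negP => le.
    by have := leq_trans bL (leq_trans Le (cut_mono eC cC t0 s0 le)); rewrite ltnn.
  have [y yL yv] : exists2 y, y \in L & 2 ^ v <= key y.
    have /fsubsetPn[y yL] : ~~ (L `<=` seg (XC (C :\ e)) (2 ^ v)).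
      apply: contraL bL => /fsubset_leq_card h; rewrite -leqNgt.
      exact: leq_trans h (cut_le_color eC cC s0).
    by rewrite in_seg (initial_pred hL yL) /= -leqNgt; exists y.
  have edge j u : j \in C :\ e -> 0 < u -> vtx j u <= v ->
      upd (upd (zpt n) e t) j u \in D.
    move=> jC u0 jv; have je : j != e by move: jC; rewrite !inE => /andP[].
    have : upd (zpt n) j u \in L.
      apply: (initial_closed hL yL); first by apply: XC_single (C2c e eC) jC.
      by rewrite key_single // (leq_trans _ yv) // leq_exp2l.
    by rewrite in_lay => /andP[_]; rewrite (updC _ _ _ je).
  suff /fsubset_leq_card h : seg (XC C) (2 ^ v.+1) `<=` D'.
    by rewrite ltnNge h in mc.
  apply/fsubsetP=> x; rewrite in_seg => /andP[xC /key_ltP xv]; rewrite in_del.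
  have xt : x e != t.
    apply/eqP => xe; have := xv e; rewrite xe -lt0n => /(_ t0).
    by rewrite ltnS leqNgt ve.
  (* If [x] has a vertex at some [j] other than [e], the edge from that vertex to the last vertex
     puts the last vertex into the layer of [x j]. Being initial, this layer then contains [x] with
     [j] zeroed. Otherwise [x] lies on the axis of [e], below [t]. *)
  rewrite xt andbT; case: (pickP [pred j | (j != e) && (x j != 0)]) => [j /andP[je xj]|none].
    have jC : j \in C by apply: contraNT xj => /(XC_zero xC)->.
    have xj0 : 0 < x j by rewrite lt0n.
    have wl : upd (zpt n) e t \in lay j (x j) D.
      rewrite in_lay (upd_neq _ _ je) ffunE eqxx edge ?inE ?je //.
      by rewrite -ltnS xv.
    have : upd x j 0 \in lay j (x j) D.
      apply: (initial_closed (layI j (x j) jC xj0) wl); first exact: XC_upd0.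
      rewrite key_single // ltnW //; apply: (@leq_ltn_trans (key x)).
        by apply: key_mono => k; rewrite updE; case: (k == j).
      apply: (@leq_trans (2 ^ v.+1)); first by apply/key_ltP.
      by rewrite leq_exp2l.
    by rewrite in_lay updK (upd_id (erefl (x j))) => /andP[].
  apply: dD x1D _ => j; case: (eqVneq j e) => [->|je].
    case: (posnP (x e)) => [->//|xe0]; rewrite leqNgt; apply/negP => lt.
    have := xv e; rewrite -lt0n => /(_ xe0); rewrite ltnS leqNgt => /negP; apply.
    by apply: leq_trans ve _; apply: vtx_le; apply: ltnW.
  by have := none j; rewrite /= je /= => /negbFE/eqP ->; rewrite ?leq0n.
have [_ W1 _ W2] := regular_max n_gt0 C3 H eC.
have [hw hs] : weight D' <= fmax C #|` D'| /\ spn C D' <= rmax C #|` D'|.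
  by apply: IH => //; rewrite cD -addn1 leq_add2l.
have dL : down L by apply: down_lay.
have [exL _ _] := H e eC; have [hw' hs'] := exL L dL (fun x => @initial_pred _ _ _ x hL).
split.
  rewrite (weight_del_lay e D t0) cD; apply: leq_trans (W1 c s _ _ cC s0 cm Lb).
  by apply: leq_add hw _; rewrite leq_add2r.
apply: leq_trans (spn_del_lay D C3 eC t0) _; rewrite cD.
exact: leq_trans (leq_add hs hs') (W2 c s _ _ cC s0 cm Lb).
Qed.

Lemma extremal_step C : 2 < #|C| ->
  (forall c, c \in C -> [/\ extremal (C :\ c), regular (C :\ c) (fmax (C :\ c)) &
                            regular (C :\ c) (rmax (C :\ c))]) ->
  extremal C.
Proof.
move=> C3 H D; have C2c d : d \in C -> 1 < #|C :\ d|.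
  by move=> dC; rewrite (cardsD1 d) dC in C3.
(* The outer induction on the size serves [compressed_bound]; the inner one is on the key sum, which
   drops with every effective compression. *)
have [m] := ubnP #|` D|; elim: m D => // m IHm D.
have [k] := ubnP (\sum_(x <- D) key x); elim: k D => // k IHk D Dk Dm dD DC.
case: (boolP [exists c in C, [exists x : D, (0 < fsval x c) &&
    (Iseg (XC (C :\ c)) #|` lay c (fsval x c) D| != lay c (fsval x c) D)]]).
  case/exists_inP=> c cC /existsP[x /andP[x0 nI]]; have [exc _ _] := H c cC.
  have nI' : ~ initial (XC (C :\ c)) (lay c (fsval x c) D).
    by move=> hI; case/eqP: nI; apply: Iseg_eq => //; apply: card_Iseg_XC; apply: C2c.
  have lt := key_sum_compress C3 cC DC x0 nI'.
  have [||||h1 h2] := IHk (compress C c D).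
  - by rewrite -ltnS (leq_trans _ Dk).
  - by rewrite card_compress.
  - exact: down_compress.
  - exact: compress_XC.
  rewrite card_compress // in h1 h2; split.
    exact: leq_trans (weight_compress C3 cC exc dD DC) h1.
  exact: leq_trans (spn_compress C3 cC exc dD DC) h2.
rewrite negb_exists_in => /forall_inP allI.
apply: compressed_bound => // [S SD|c t cC t0].
  by apply: IHm; apply: leq_trans SD _; rewrite -ltnS.
case: (fset_0Vmem (lay c t D)) => [->|[y]].
  by rewrite -(Iseg_XC0 (C2c c cC)); apply: Iseg_initial.
rewrite in_lay => /andP[_ yD]; have := allI c cC; rewrite negb_exists => /forallP.
move/(_ [` yD]); rewrite /= upd_eq t0 /= negbK => /eqP<-; exact: Iseg_initial.
Qed.

Lemma extremal_all C : 1 < #|C| ->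
  [/\ extremal C, regular C (fmax C) & regular C (rmax C)].
Proof.
have [k] := ubnP #|C|; elim: k C => // k IH C Ck C2.
case: (ltngtP #|C| 2) => [|C3|/extremal_two_colors //]; first by rewrite ltnNge C2.
have H c : c \in C -> [/\ extremal (C :\ c), regular (C :\ c) (fmax (C :\ c)) &
                            regular (C :\ c) (rmax (C :\ c))].
  move=> cC; rewrite (cardsD1 c) cC add1n in Ck C3; exact: IH.
have /card_gt0P[c cC] : 0 < #|C| by rewrite ltnW.
have [r1 _ r2 _] := regular_max n_gt0 C3 H cC.
by split=> //; apply: extremal_step.
Qed.

End Extremal.

(** * From weak antichains to down-sets *)

Section Pushing.

Variable n : nat.
Local Notation pt := {ffun 'I_n -> nat}.
Implicit Types (x y z : pt) (i j : 'I_n) (A : {fset pt}).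

Definition pr j A : {fset pt} := [fset upd x j 0 | x in A].

(** On each line in direction [i], only the first point at or above level [s] is lowered to [s].
    Level 0 is used to reach [X_n], and arbitrary levels to fill gaps until the set is a
    down-set. *)
Definition lowest i s A x := (s <= x i) &&
  [forall y : A, (upd (fsval y) i s == upd x i s) ==> (s <= fsval y i) ==>
                 (x i <= fsval y i)].

Definition push i s A x := if lowest i s A x then upd x i s else x.

Definition pushed i s A : {fset pt} := [fset push i s A x | x in A].

Lemma lowestP i s A x : reflect
  (s <= x i /\ forall y, y \in A -> upd y i s = upd x i s -> s <= y i -> x i <= y i)
  (lowest i s A x).
Proof.
apply: (iffP andP) => -[sx h]; split=> //.
  move=> y yA e sy; have /forallP/(_ [` yA]) := h.
  by rewrite /= e eqxx sy.
by apply/forallP=> y; apply/implyP=> /eqP e; apply/implyP; apply: h => //; apply: valP.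
Qed.

Lemma push_le i s A x j : push i s A x j <= x j.
Proof.
rewrite /push; case: ifP => // /lowestP[sx _].
by rewrite updE; case: eqP => [->|].
Qed.

(** Each line has only one point to move, and if the target is occupied, its occupant is that
    point. *)
Lemma push_inj i s A : {in A &, injective (push i s A)}.
Proof.
have aux x y : y \in A -> lowest i s A x -> upd x i s = y -> x = y.
  move=> yA /lowestP[sx h] e.
  have := h y yA; rewrite -{1}e updK -e upd_eq => /(_ erefl (leqnn _)) le.
  by rewrite upd_id //; apply/eqP; rewrite eqn_leq le.
move=> x y xA yA; rewrite /push.
case: ifP => hx; case: ifP => hy // e; last 2 first.
- exact: aux yA hx e.
- by symmetry; apply: aux xA hy _.
case/lowestP: hx => sx hx; case/lowestP: hy => sy hy.
apply: (upd_inj _ e); apply/eqP; rewrite eqn_leq; apply/andP; split; [exact: hx | exact: hy].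
Qed.

Lemma card_pushed i s A : #|` pushed i s A| = #|` A|.
Proof. by rewrite card_in_imfset //=; apply: push_inj. Qed.

Lemma upd_pushed i s A x : x \in A -> s <= x i -> upd x i s \in pushed i s A.
Proof.
move=> xA sx; have ex : exists t, (s <= t) && (upd x i t \in A).
  by exists (x i); rewrite sx upd_id.
case: (ex_minnP ex) => t /andP[st tA] tmin.
apply/imfsetP; exists (upd x i t) => //=; rewrite /push.
case: ifP => [_|/negP[]]; first by rewrite updK.
apply/lowestP; rewrite upd_eq; split=> // y yA; rewrite updK => e sy.
apply: tmin; rewrite sy -(updK x i s) -e updK upd_id //.
Qed.

(** For [j] equal to [i] the lines met are the same. Otherwise the projection of the pushed set lies
    in the pushed projection: a point that is not lowest on its line cannot become lowest after
    projecting. *)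
Lemma card_pr_pushed i j s A : #|` pr j (pushed i s A)| <= #|` pr j A|.
Proof.
case: (eqVneq j i) => [->|ji].
  apply: fsubset_leq_card; apply/fsubsetP=> _ /imfsetP[_ /= /imfsetP[x /= xA ->] ->].
  apply/imfsetP; exists x => //; rewrite /push; case: ifP => // _.
  by rewrite updK.
rewrite -(card_pushed i s (pr j A)); apply: fsubset_leq_card.
have ij : i != j by rewrite eq_sym.
apply/fsubsetP=> _ /imfsetP[_ /= /imfsetP[x /= xA ->] ->].
have uA : upd x j 0 \in pr j A by apply/imfsetP; exists x.
have ui : upd x j 0 i = x i by rewrite upd_neq.
rewrite {1}/push; case: ifP => [/lowestP[sx _]|hx].
  by rewrite updC //; apply: upd_pushed; rewrite ?ui.
apply/imfsetP; exists (upd x j 0) => //=; rewrite /push; case: ifP => // hu.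
case/negP: hx; case/lowestP: hu => su hu; apply/lowestP.
rewrite ui in su hu; split=> // y yA e sy.
have := hu (upd y j 0); rewrite (upd_neq y 0 ij); apply=> //.
  by apply/imfsetP; exists y.
by rewrite updC // e updC.
Qed.

(* A point that no push has moved lies above the points witnessing that it was
   not lowest; following these witnesses back to [A] decreases one more coordinate
   at each step. *)
Lemma zeroed A (l : seq 'I_n) : uniq l ->
  let S := foldr (fun i S => pushed i 0 S) A l in
  [/\ #|` S| = #|` A|, forall j, #|` pr j S| <= #|` pr j A| &
   forall x, x \in S -> (forall j, j \in l -> 0 < x j) ->
     x \in A /\ exists2 y, y \in A &
       (forall j, j \in l -> y j < x j) /\ (forall j, j \notin l -> y j = x j)].
Proof.
elim: l => [_|i l IH] /=; first by split=> // x xA _; split=> //; exists x.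
case/andP=> il /IH; set S := foldr _ _ _ => -[cS pS hS]; split.
- by rewrite card_pushed.
- by move=> j; apply: leq_trans (card_pr_pushed _ _ _ _) (pS j).
move=> _ /imfsetP[x /= xS ->]; rewrite /push; case: ifP => [_ h|hx h].
  by have := h i; rewrite inE eqxx upd_eq => /(_ isT).
have hl (z : pt) : (forall j, j != i -> z j = x j) -> forall j, j \in l -> 0 < z j.
  move=> zx j jl; rewrite zx; first by apply: h; rewrite inE jl orbT.
  by apply: contraNneq il => <-.
have [xA _] := hS x xS (hl x (fun _ _ => erefl)); split=> //.
have [z zS [zx ze]] : exists2 z, z \in S & z i < x i /\ forall j, j != i -> z j = x j.
  move/negbT: hx; rewrite /lowest leq0n /= negb_forall => /existsP[z].
  rewrite !negb_imply -ltnNge ?leq0n /= => /andP[/eqP e zx]; exists (fsval z); first exact: valP.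
  split=> // j ji; have := congr1 (fun u : pt => u j) e.
  by rewrite !(upd_neq _ _ ji).
have [_ [y yA [yl ynl]]] := hS z zS (hl z ze); exists y => //; split=> j.
  rewrite inE => /orP[/eqP->|jl]; first by rewrite ynl.
  by rewrite -ze ?yl //; apply: contraNneq il => <-.
by rewrite inE negb_or => /andP[ji jl]; rewrite ynl // ze.
Qed.

Lemma down_coord A : (forall x i s, x \in A -> s <= x i -> upd x i s \in A) -> down A.
Proof.
move=> h x y xA yx.
pose z (l : seq 'I_n) : pt := [ffun j => if j \in l then y j else x j].
have -> : y = z (enum 'I_n) by apply/ffunP=> j; rewrite ffunE mem_enum.
elim: (enum 'I_n) => [|i l IH].
  by have -> : z [::] = x by apply/ffunP=> j; rewrite ffunE.
have -> : z (i :: l) = upd (z l) i (y i).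
  apply/ffunP=> j; rewrite updE !ffunE inE.
  by case: eqP => [->|].
by apply: h => //; rewrite ffunE; case: ifP.
Qed.

(** While some point can be lowered at one coordinate to a missing position, push at that level; the
    total of all coordinates drops. *)
Lemma downward A : (forall x, x \in A -> XC setT x) -> exists S,
  [/\ down S, forall x, x \in S -> XC setT x, #|` S| = #|` A| &
      forall j, #|` pr j S| <= #|` pr j A|].
Proof.
have [k] := ubnP (\sum_(x <- A) \sum_i x i); elim: k A => // k IH A Ak AX.
case: (boolP [exists x : A, [exists i, [exists s : 'I_(fsval x i).+1,
    upd (fsval x) i s \notin A]]]); last first.
  rewrite negb_exists => /forallP h; exists A; split=> //; apply: down_coord.
  move=> x i s xA sx; have := h [` xA]; rewrite negb_exists => /forallP/(_ i).
  rewrite negb_exists => /forallP/(_ (Ordinal (sx : s < (x i).+1))) /=.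
  by rewrite negbK.
case/existsP=> -[x xA] /existsP[i /existsP[[s /= sx] nA]]; rewrite ltnS in sx.
have le : \sum_(y <- pushed i s A) \sum_j y j < \sum_(y <- A) \sum_j y j.
  rewrite big_imfset /=; last exact: push_inj.
  have lej y : \sum_j push i s A y j <= \sum_j y j.
    by apply: leq_sum => j _; apply: push_le.
  rewrite (big_fsetID _ (fun y => push i s A y == y)) /=.
  rewrite [X in _ < X](big_fsetID _ (fun y => push i s A y == y)) /=.
  rewrite -addnS; apply: leq_add; first exact: leq_sum.
  have [y yA py] : exists2 y, y \in A & push i s A y != y.
    have /imfsetP[y /= yA e] := upd_pushed xA sx; exists y => //.
    by apply: contraNneq nA => ey; rewrite e ey.
  have yT : y \in [fset y in A | push i s A y != y] by rewrite !inE yA.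
  rewrite !(big_fsetD1 y yT) /= -addSn; apply: leq_add; last exact: leq_sum.
  rewrite ltn_neqAle lej andbT; apply: contra py => /eqP ey.
  apply/eqP/ffunP=> j; apply/eqP.
  have [_] := leqif_sum (fun j (_ : true) => leqif_eq (push_le i s A y j)).
  by rewrite ey eqxx => /esym/forallP/(_ j).
have [|y yP|S [dS XS cS pS]] := IH (pushed i s A).
- by rewrite -ltnS (leq_trans _ Ak).
- case/imfsetP: yP => z /= zA ->; apply: XC_le (AX z zA) => j; exact: push_le.
exists S; split=> //; first by rewrite cS card_pushed.
by move=> j; apply: leq_trans (pS j) (card_pr_pushed _ _ _ _).
Qed.

(** In a down-set the projection along [j] is the set of points with entry 0 at [j], so the sum
    counts zero entries and the weight counts nonzero ones. *)
Lemma sum_pr_down S : down S -> \sum_j #|` pr j S| + weight S = n * #|` S|.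
Proof.
move=> dS; have prE j : #|` pr j S| = \sum_(x <- S) (x j == 0).
  have -> : pr j S = [fset x in S | x j == 0].
    apply/fsetP=> y; rewrite !inE; apply/imfsetP/andP => [[x /= xS ->]|[yS /eqP yj]].
      rewrite upd_eq; split=> //; apply: dS xS _ => k; rewrite updE.
      by case: (k == j).
    by exists y => //; rewrite upd_id.
  rewrite card_fset_sum1 -big_fset_condE big_mkcond /=.
  by apply: eq_bigr => x _; case: (x j == 0).
under eq_bigr do rewrite prE.
rewrite exchange_big /weight -big_split /= card_fset_sum1 big_distrr /=.
apply: eq_bigr => x _; have -> : \sum_j nat_of_bool (x j == 0) = #|~: supp x|.
  rewrite -sum1_card [RHS]big_mkcond /=; apply: eq_bigr => j _.
  by rewrite !inE negbK; case: (x j == 0).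
by rewrite muln1 addnC cardsC card_ord.
Qed.

Definition nat_antichain A := forall x y, x \in A -> y \in A -> ~ (forall i, x i < y i).

Lemma sum_pr_bound A : 1 < n -> nat_antichain A ->
  n * #|` A| <= \sum_j #|` pr j A| + fmax [set: 'I_n] #|` A|.
Proof.
move=> n2 antiA; have [c1 p1 h1] := zeroed A (enum_uniq 'I_n).
set S1 := foldr _ _ _ in c1 p1 h1.
have [|S [dS XS c2 p2]] := @downward S1.
  (* A point left without a zero would belong to [A] and lie strictly above another point of [A]. *)
  move=> x xS; rewrite /XC properT; apply/negP => /eqP e.
  have [j _|xA [y yA [yx _]]] := h1 x xS.
    by rewrite lt0n -in_supp e inE.
  by apply: antiA yA xA _ => i; apply: yx; rewrite mem_enum.
have C2 : 1 < #|[set: 'I_n]| by rewrite cardsT card_ord.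
have [ex _ _] := extremal_all (ltnW n2) C2; have [hw _] := ex S dS XS.
rewrite -c1 -c2 -(sum_pr_down dS) leq_add //.
by apply: leq_sum => j _; apply: leq_trans (p2 j) (p1 j).
Qed.

Lemma sum_pr_initial I : 1 < n -> initial (XC [set: 'I_n]) I ->
  \sum_j #|` pr j I| + fmax [set: 'I_n] #|` I| = n * #|` I|.
Proof.
move=> n2 hI; have C2 : 1 < #|[set: 'I_n]| by rewrite cardsT card_ord.
rewrite -(sum_pr_down (down_initial hI)) /fmax Iseg_eq //.
exact: card_Iseg_XC.
Qed.

End Pushing.

(** * Integer points *)

Section Transfer.

Variable n : nat.
Local Notation pt := {ffun 'I_n -> nat}.

Lemma card_imfset_le (T U V : choiceType) (f : T -> U) (g : T -> V) (A : {fset T}) :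
  {in A &, forall x y, g x = g y -> f x = f y} -> #|` f @` A| <= #|` g @` A|.
Proof.
move=> gf; case: (fset_0Vmem A) => [->|[x0 x0A]]; first by rewrite !imfset0 !cardfs0.
(* [F] factors [f] through [g] by choosing a preimage; [x0] is the default off the image. *)
pose F v := f (odflt x0 (omap val [pick x : A | g (fsval x) == v])).
have -> : #|` f @` A| = #|` F @` (g @` A)|; last exact: leq_imfset_card.
apply: (congr1 (fun S : {fset U} => #|` S|)); apply/fsetP=> u.
have FE x : x \in A -> F (g x) = f x.
  move=> xA; rewrite /F; case: pickP => [y /= /eqP e|/(_ [` xA])]; last by rewrite /= eqxx.
  by apply: gf => //; apply: valP.
apply/imfsetP/imfsetP => [[x /= xA ->]|[_ /= /imfsetP[x /= xA ->] ->]].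
  by exists (g x); [apply/imfsetP; exists x | rewrite FE].
by exists x => //; rewrite FE.
Qed.

Lemma card_imfset_eq (T U V : choiceType) (f : T -> U) (g : T -> V) (A : {fset T}) :
  {in A &, forall x y, f x = f y <-> g x = g y} -> #|` f @` A| = #|` g @` A|.
Proof.
move=> fg; apply/eqP; rewrite eqn_leq !card_imfset_le // => x y xA yA.
  by case: (fg x y xA yA).
by case: (fg x y xA yA).
Qed.

(** Translation by [K] in every coordinate; the absolute value is harmless on sets satisfying
    [above K]. *)
Definition nat_pt (K : nat) (x : point n) : pt := [ffun i => absz (x i + K%:Z)%R].

Definition int_pt (x : pt) : point n := [ffun i => Posz (x i)].

Lemma int_ptK (x : pt) : nat_pt 0 (int_pt x) = x.
Proof. by apply/ffunP=> i; rewrite !ffunE addr0. Qed.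

Lemma nat_ptK (x : point n) : (forall i, 0 <= x i)%R -> int_pt (nat_pt 0 x) = x.
Proof. by move=> h; apply/ffunP=> i; rewrite !ffunE addr0 gez0_abs. Qed.

Lemma absz_shift_lt (a b : int) (K : nat) : (0 <= a + K%:Z)%R -> (0 <= b + K%:Z)%R ->
  (absz (a + K%:Z)%R < absz (b + K%:Z)%R) = (a < b)%R.
Proof. by move=> ha hb; rewrite -ltz_nat !gez0_abs // ltrD2r. Qed.

Lemma absz_shift_inj (a b : int) (K : nat) : (0 <= a + K%:Z)%R -> (0 <= b + K%:Z)%R ->
  absz (a + K%:Z)%R = absz (b + K%:Z)%R -> a = b.
Proof. by move=> ha hb /(congr1 Posz); rewrite !gez0_abs // => /addIr. Qed.

Definition above K (A : {fset point n}) := forall x, x \in A -> forall i, (0 <= x i + K%:Z)%R.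

Lemma nat_pt_inj K A : above K A -> {in A &, injective (nat_pt K)}.
Proof.
move=> aA x y xA yA e; apply/ffunP=> i.
have := congr1 (fun z : pt => z i) e; rewrite !ffunE.
exact: absz_shift_inj (aA x xA i) (aA y yA i).
Qed.

Lemma card_pr_nat K A i : above K A ->
  #|` pr i (nat_pt K @` A)| = #|` [fset proj i x | x in A]|.
Proof.
move=> aA; have -> : pr i (nat_pt K @` A) = [fset upd (nat_pt K x) i 0 | x in A].
  apply/fsetP=> u; apply/imfsetP/imfsetP => [[_ /= /imfsetP[x /= xA ->] ->]|[x /= xA ->]].
    by exists x.
  by exists (nat_pt K x) => //; apply/imfsetP; exists x.
apply: card_imfset_eq => x y xA yA; split=> e; apply/ffunP=> j.
  have := congr1 (fun z : pt => z (lift i j)) e; rewrite !updE !ffunE.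
  rewrite (eq_sym (lift i j) i) (negbTE (neq_lift i j)).
  exact: absz_shift_inj (aA x xA (lift i j)) (aA y yA (lift i j)).
rewrite !updE; case: (eqVneq j i) => // ji; rewrite eq_sym in ji.
have [k e' _] := unlift_some ji.
by have := congr1 (fun z : point n.-1 => z k) e; rewrite !ffunE e' => ->.
Qed.

Lemma gapE K A : above K A ->
  (gap A + #|` A|%:Z = (\sum_(i < n) #|` pr i (nat_pt K @` A)|)%N%:Z)%R.
Proof.
move=> aA; rewrite /gap subrK (big_morph Posz PoszD (erefl _)); apply: eq_bigr => i _.
by rewrite card_pr_nat.
Qed.

(** * The balanced order in terms of keys *)

Lemma diff_int_pt (x y : pt) :
  diff_coords (int_pt x) (int_pt y) = [set i | x i != y i].
Proof. by apply/setP=> i; rewrite !inE !ffunE. Qed.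

Lemma max_on_int_pt (T : {set 'I_n}) (x : pt) :
  max_on T (int_pt x) = Posz (\max_(i in T) x i).
Proof.
rewrite /max_on (big_morph Posz (id1 := 0%R) (op1 := Num.max)) //.
  by apply: eq_bigr => i _; rewrite ffunE.
by move=> a b; lia.
Qed.

Lemma argmax_on_int_pt (T : {set 'I_n}) (x : pt) i0 : i0 \in T ->
  exists2 i : 'I_n, i \in T /\ x i = \max_(j in T) x j &
    argmax_on T (int_pt x) = i /\
    forall j, j \in T -> x j = \max_(j in T) x j -> j <= i.
Proof.
move=> i0T; have T0 : 0 < #|T| by apply/card_gt0P; exists i0.
have [i1 i1T e1] := eq_bigmax_cond x T0; set M := \max_(j in T) x j in e1 *.
pose A := [pred i | (i \in T) && (x i == M)].
have A0 : 0 < #|A| by apply/card_gt0P; exists i1; rewrite inE i1T e1 eqxx.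
have [i iA e] := eq_bigmax_cond (fun i : 'I_n => i : nat) A0.
have argE : argmax_on T (int_pt x) = \max_(j in A) j.
  by apply: eq_bigl => j; rewrite !inE max_on_int_pt ffunE eqz_nat.
exists i; first by move: iA; rewrite inE => /andP[? /eqP].
split; first by rewrite argE e.
by move=> j jT xj; rewrite -e; apply: leq_bigmax_cond; rewrite inE jT xj eqxx.
Qed.

Lemma balanced_ltE (x y : pt) : balanced_lt (int_pt x) (int_pt y) = (key x < key y).
Proof.
have lt_key (u v : pt) : balanced_lt (int_pt u) (int_pt v) -> key u < key v.
  rewrite /balanced_lt diff_int_pt; set T := [set i | _] => /andP[uv].
  have [i0 i0T] : exists i, i \in T.
    apply/set0Pn; apply: contra uv => /eqP T0; apply/eqP/ffunP=> i; rewrite !ffunE.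
    by apply/eqP; have := in_set0 i; rewrite -T0 inE eqz_nat => /negbFE.
  have [i [iT ui] [-> imax]] := argmax_on_int_pt u i0T.
  have [j [jT vj] [-> jmax]] := argmax_on_int_pt v i0T.
  rewrite !max_on_int_pt ltz_nat eqz_nat -ui -vj => h.
  have u_le k : k \in T -> u k <= u i by move=> kT; rewrite ui; apply: leq_bigmax_cond.
  have v_le k : k \in T -> v k <= v j by move=> kT; rewrite vj; apply: leq_bigmax_cond.
  have uv_le : u i <= v j by case/orP: h => [/ltnW//|/andP[/eqP-> _]].
  have uvj : u j != v j by move: jT; rewrite inE.
  (* The last maximal entry of [v] among the differing coordinates is its deciding vertex. *)
  apply: (@dominates_lt _ _ _ j); split=> //.
    by apply: contraNneq uvj => v0; have := u_le j jT; rewrite eqn_leq v0; lia.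
  move=> k uvk uk; have kT : k \in T by rewrite inE.
  case: (ltnP (u k) (v j)) => [lt|le].
    rewrite -(prednK (_ : 0 < u k)) ?lt0n // -(prednK (_ : 0 < v j)); last lia.
    by apply: vtx_lt; rewrite -lt0n in uk; lia.
  have e : u k = v j by apply/eqP; rewrite eqn_leq le (leq_trans (u_le k kT)).
  rewrite e /vtx ltn_add2l; case/orP: h => [lt|/andP[/eqP e2 ij]].
    by have := u_le k kT; rewrite e leqNgt lt.
  by apply: leq_ltn_trans ij; apply: imax; rewrite // -ui e2.
apply/idP/idP => [|kxy]; first exact: lt_key.
have xy : x != y by apply: contraTneq kxy => ->; rewrite ltnn.
have xy' : int_pt x != int_pt y.
  by apply: contra xy => /eqP/(congr1 (nat_pt 0)); rewrite !int_ptK => ->.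
(* The reverse comparison fails by the first half. A tie in both maxima and last positions would
   give equal entries at a coordinate where [x] and [y] differ, so the comparison itself holds. *)
have nyx : ~~ balanced_lt (int_pt y) (int_pt x).
  by apply/negP => /lt_key; rewrite ltnNge ltnW.
move: nyx; rewrite /balanced_lt (eq_sym (int_pt y)) xy' /=.
have -> : diff_coords (int_pt y) (int_pt x) = diff_coords (int_pt x) (int_pt y).
  by apply/setP=> i; rewrite !inE eq_sym.
rewrite diff_int_pt; set T := [set i | _].
have [i0 i0T] : exists i, i \in T.
  apply/set0Pn; apply: contra xy => /eqP T0; apply/eqP/ffunP=> i.
  by apply/eqP; have := in_set0 i; rewrite -T0 inE => /negbFE.
have [i [iT xi] [-> _]] := argmax_on_int_pt x i0T.
have [j [jT yj] [-> _]] := argmax_on_int_pt y i0T.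
rewrite !max_on_int_pt !ltz_nat !eqz_nat -xi -yj.
case: (ltngtP (x i) (y j)) => //= e; rewrite -leqNgt leq_eqVlt => /orP[|//].
by move/eqP/val_inj => ij; move: iT; rewrite inE e ij eqxx.
Qed.

Lemma in_X_int_pt (x : pt) : in_X (int_pt x) = XC [set: 'I_n] x.
Proof.
rewrite /in_X /XC properT; have -> : [forall i, (0 <= int_pt x i)%R].
  by apply/forallP=> i; rewrite ffunE.
apply/existsP/idP => [[i]|h].
  by rewrite ffunE eqz_nat => xi; apply/eqP => /setP/(_ i); rewrite !inE xi.
apply/existsP; apply: contraR h; rewrite negb_exists => /forallP h.
by apply/eqP/setP=> i; have := h i; rewrite ffunE eqz_nat !inE.
Qed.

Lemma in_X_ge0 (x : point n) : in_X x -> forall i, (0 <= x i)%R.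
Proof. by case/andP=> /forallP. Qed.

Lemma in_X_nat_pt (x : point n) : in_X x -> int_pt (nat_pt 0 x) = x.
Proof. by move=> /in_X_ge0/nat_ptK. Qed.

Lemma initial_segment_nat m (I : {fset point n}) :
  initial_segment m I -> initial (XC [set: 'I_n]) (nat_pt 0 @` I).
Proof.
case=> IX _ Icl; apply: initialP => [_ /imfsetP[x /= xI ->]|].
  by rewrite -in_X_int_pt in_X_nat_pt // IX.
move=> _ y /imfsetP[x /= xI ->] yX yx; apply/imfsetP; exists (int_pt y); last first.
  by rewrite int_ptK.
apply: contraTT yx => yI; rewrite -leqNgt ltnW // -balanced_ltE.
rewrite (in_X_nat_pt (IX x xI)); apply: Icl => //.
by rewrite in_X_int_pt.
Qed.

Lemma initial_segment_exists m : 1 < n -> exists I : {fset point n}, initial_segment m I.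
Proof.
move=> n2; have C2 : 1 < #|[set: 'I_n]| by rewrite cardsT card_ord.
have hI := Iseg_initial (XC [set: 'I_n]) m; exists (int_pt @` Iseg (XC [set: 'I_n]) m).
have int_inj : injective int_pt by apply: can_inj int_ptK.
split=> [_ /imfsetP[x /= xI ->]||_ y /imfsetP[x /= xI ->] yX yI].
- by rewrite in_X_int_pt (initial_pred hI xI).
- by rewrite card_imfset //= card_Iseg_XC.
rewrite -(in_X_nat_pt yX) balanced_ltE ltnNge; apply: contra yI => le.
apply/imfsetP; exists (nat_pt 0 y); last by rewrite in_X_nat_pt.
by apply: (initial_closed hI xI _ le); rewrite -in_X_int_pt in_X_nat_pt.
Qed.

(** Gap plus size is the sum of the projections, which for size [m] is at least [n * m] minus [fmax
    [set: 'I_n] m], with equality for initial segments. *)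
Lemma initial_segment_minimises m (I : {fset point n}) : 1 < n ->
  initial_segment m I -> minimises_gap m I.
Proof.
move=> n2 hI; have [IX cI _] := hI; split=> //.
  move=> x y xI yI lt; have /andP[_ /existsP[j /eqP yj]] := IX y yI.
  by have := lt j; rewrite yj ltNge in_X_ge0 // IX.
move=> A antiA cA.
have aI : above 0 I by move=> x xI i; rewrite addr0 in_X_ge0 // IX.
(* Large enough to translate all of [A] into the nonnegative orthant. *)
pose K := \sum_(x <- A) \sum_i absz (x i).
have aA : above K A.
  move=> x xA i; suff : absz (x i) <= K by move: (x i) => a; lia.
  by rewrite /K (big_fsetD1 x xA) /= (bigD1 i) //= -addnA leq_addr.
have antiN : nat_antichain (nat_pt K @` A).
  move=> _ _ /imfsetP[x /= xA ->] /imfsetP[y /= yA ->] lt.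
  apply: (antiA x y xA yA) => i; have := lt i; rewrite !ffunE.
  by rewrite absz_shift_lt //; [exact: aA | exact: aA].
have cN (k : nat) B : above k B -> #|` nat_pt k @` B| = #|` B|.
  by move=> aB; rewrite card_in_imfset //=; apply: nat_pt_inj aB.
have hA := sum_pr_bound n2 antiN; have hI' := sum_pr_initial n2 (initial_segment_nat hI).
have gA := gapE aA; have gI := gapE aI.
rewrite (cN _ _ aA) cA in hA; rewrite (cN _ _ aI) cI in hI'.
rewrite cA in gA; rewrite cI in gI.
by rewrite -(lerD2r m%:Z) gA gI lez_nat -(leq_add2r (fmax [set: 'I_n] m)) hI'.
Qed.

(** * The faces of a cube *)

Lemma grid_point_inj N : injective (@grid_point n N).
Proof.
move=> f g e; apply/ffunP=> i; apply: val_inj.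
by have := congr1 (fun x : point n => x i) e; rewrite !ffunE => -[].
Qed.

Lemma card_cube_faces N : 0 < N -> #|` cube_faces n N| = (N ^ n - (N - 1) ^ n)%N.
Proof.
case: N => // N _; rewrite subn1 /= card_imfset /=; last exact: grid_point_inj.
pose nz : pred 'I_N.+1 := predC1 ord0.
have cnz : #|nz| = N by rewrite cardC1 card_ord.
have cAll : #|{: {ffun 'I_n -> 'I_N.+1}}| = (N.+1 ^ n)%N by rewrite card_ffun !card_ord.
pose on : {pred {ffun 'I_n -> 'I_N.+1}} := ffun_on nz.
have cOn : #|on| = (N ^ n)%N by rewrite card_ffun_on cnz card_ord.
rewrite -cAll -cOn -(cardC on) addKn -cardE.
apply: eq_card => f; rewrite !inE; apply/existsP/idP => [[j fj]|h].
  by apply/negP => /ffun_onP/(_ j); rewrite /= inE -val_eqE /= fj.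
apply/existsP; apply: contraR h; rewrite negb_exists => /forallP h; apply/ffun_onP=> j.
by have := h j; rewrite inE.
Qed.

(** The threshold [2 ^ (n * N.-1)] separates the two sides: entries up to [N - 1] only give vertices
    below [n * N.-1], and an entry of at least [N] gives a vertex not below it. *)
Lemma cube_faces_initial N : 0 < N ->
  initial_segment (N ^ n - (N - 1) ^ n) (cube_faces n N).
Proof.
move=> N0; split=> [x|| x y]; last 1 first.
- move=> /in_cube_faces[xN [k xk]] yX yN.
  have xX : in_X x.
    apply/andP; split; first by apply/forallP=> i; case/andP: (xN i).
    by apply/existsP; exists k; rewrite xk.
  rewrite -(in_X_nat_pt xX) -(in_X_nat_pt yX) balanced_ltE.
  have [j yj] : exists j, N <= nat_pt 0 y j.
    apply/existsP; apply: contraR yN; rewrite negb_exists => /forallP h.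
    apply/in_cube_faces; split=> [i|].
      by have := in_X_ge0 yX i; have := h i; rewrite ffunE; move: (y i) => a; lia.
    by case/andP: yX => _ /existsP[j /eqP yj]; exists j.
  apply: (@leq_trans (2 ^ (n * N.-1))).
    by apply: key_lt_coord => i; have := xN i; rewrite ffunE; move: (x i) => a; lia.
  rewrite leqNgt; apply/negP => /key_ltP/(_ j); rewrite -lt0n => h.
  have := h (leq_trans N0 yj); rewrite /vtx ltnNge => /negP; apply.
  by apply: leq_trans (leq_addr _ _); rewrite leq_mul2l; apply/orP; right; lia.
- move=> /in_cube_faces[xN [k xk]].
  apply/andP; split; first by apply/forallP=> i; case/andP: (xN i).
  by apply/existsP; exists k; rewrite xk.
- exact: card_cube_faces.
Qed.

End Transfer.

Unset Implicit Arguments.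
Local Open Scope ring_scope.
Local Open Scope fset_scope.

Theorem theorem3 (n : nat) (hn : (2 <= n)%N) :
  (forall m : nat,
     (exists I : {fset point n}, initial_segment m I) /\
     (forall I : {fset point n}, initial_segment m I -> minimises_gap m I))
  /\
  (forall N : nat, (0 < N)%N ->
     #|` cube_faces n N| = (N ^ n - (N - 1) ^ n)%N /\
     minimises_gap (N ^ n - (N - 1) ^ n)%N (cube_faces n N)).
Proof.
split=> [m|N N0].
  split; first exact: initial_segment_exists.
  by move=> I; apply: initial_segment_minimises.
split; first exact: card_cube_faces.
exact: initial_segment_minimises hn (cube_faces_initial n N0).
Qed.
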